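(* Let $L$ be a locally countable Borel graph. If $L$ is a line graph and $\chi_B(L)\le\aleph_0$, then $L$ is a Borel line graph.
   Context: All graphs are simple (possibly infinite): a graph $G$ has a vertex set $V(G)$ and an edge set $E(G)\subseteq [V(G)]^2$, where $[X]^2$ is the set of 2-element subsets of $X$. For a standard Borel space $X$, $[X]^2$ carries the $\sigma$-algebra of all $A\subseteq[X]^2$ such that $\{(x,y)\in X^2 : x\ne y,\ \{x,y\}\in A\}$ is Borel in $X^2$; with it, $[X]^2$ is a standard Borel space. A Borel graph is a graph $G$ such that $V(G)$ is a standard Borel space and $E(G)$ is a Borel subset of $[V(G)]^2$. A graph is locally countable if every vertex has countably many neighbors. The line graph $L(G)$ of a graph $G$ has vertex set $E(G)$, with distinct $e,e'\in E(G)$ adjacent iff $e\cap e'\neq\emptyset$. A graph is a line graph if it is isomorphic (as an abstract graph) to $L(G)$ for some graph $G$. If $G$ is a Borel graph, so is $L(G)$. Borel graphs $G,H$ are Borel isomorphic if there is a graph isomorphism $V(G)\to V(H)$ that is a Borel function. A Borel graph $L$ is a Borel line graph if there is a Borel graph $G$ such that $L$ is Borel isomorphic to $L(G)$. For a Borel graph $G$, the Borel chromatic number $\chi_B(G)$ is the smallest cardinality of a standard Borel space $X$ for which there is a Borel function $f:V(G)\to X$ with $f(x)\ne f(y)$ for all $xy\in E(G)$. *)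

(* Defs.v *)
From mathcomp Require Import all_boot all_order all_algebra.
From mathcomp Require Import all_classical all_reals all_analysis.

Set Implicit Arguments.
Unset Strict Implicit.
Unset Printing Implicit Defensive.

Local Open Scope classical_set_scope.
Local Open Scope card_scope.

(* [measurableType] is pointed, which would exclude the empty space and the
   edge space of an edgeless graph; hence this unpointed variant.  Nothing is
   required of [borel] here: see [standard_borel]. *)
Record borelSpace := BorelSpace {
  carrier :> Type;
  borel : set (set carrier)
}.

Definition borel_fun (X Y : borelSpace) (f : X -> Y) : Prop :=
  forall B : set Y, borel B -> borel (f @^-1` B).

Definition subspace_borel (X : borelSpace) (A : set X) : borelSpace :=
  @BorelSpace A (preimage_set_system setT (@set_val X A) (@borel X)).

Definition square_borel (X : borelSpace) : borelSpace :=
  @BorelSpace (X * X)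
    <<s preimage_set_system setT fst (@borel X) `|`
        preimage_set_system setT snd (@borel X) >>.

Definition separable_space (T : topologicalType) : Prop :=
  exists2 D : set T, countable D & dense D.

(* [completeType] is pointed, so completeness is spelled out. *)
Definition complete_space (T : uniformType) : Prop :=
  forall F : set_system T, ProperFilter F -> cauchy F -> exists x : T, F --> x.

(* The bijection [f] transports a Polish topology to [X]. *)
Definition standard_borel (R : realType) (X : borelSpace) : Prop :=
  exists P : metricType R,
    [/\ separable_space P, complete_space P &
        exists2 f : X -> P, bijective f &
          @borel X = preimage_set_system setT f <<s @open P >>].

Definition two_subset (X : Type) : Type :=
  {A : set X | exists x y : X, x <> y /\ A = [set x; y]}.

Definition upair (X : Type) (x y : X) (xy : x <> y) : two_subset X :=
  exist _ [set x; y] (ex_intro _ x (ex_intro _ y (conj xy erefl))).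

Definition two_subset_borel (X : borelSpace) : borelSpace :=
  @BorelSpace (two_subset X)
    [set A | @borel (square_borel X)
               [set xy | exists h : xy.1 <> xy.2, A (upair h)]].

Record graph := Graph {
  vertex : Type;
  edge : set (two_subset vertex)
}.

Definition adj (G : graph) (x y : vertex G) : Prop :=
  exists h : x <> y, edge (upair h).

Definition locally_countable (G : graph) : Prop :=
  forall x : vertex G, countable [set y | adj x y].

Definition graph_iso (G H : graph) (f : vertex G -> vertex H) : Prop :=
  bijective f /\ forall x y : vertex G, adj x y <-> adj (f x) (f y).

Definition line_edge (V : Type) (E : set (two_subset V)) :
    set (two_subset E) :=
  [set p | exists (e e' : E) (h : e <> e'),
     p = upair h /\ sval (set_val e) `&` sval (set_val e') !=set0].

Definition line_graph (G : graph) : graph := Graph (@line_edge _ (@edge G)).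

Definition is_line_graph (L : graph) : Prop :=
  exists (G : graph) (f : vertex L -> vertex (line_graph G)), graph_iso f.

(* A graph whose vertices carry a system of Borel sets; it is a Borel graph
   when [is_borel_graph] holds. *)
Record graphOnBorel := GraphOnBorel {
  vspace : borelSpace;
  bedge : set (two_subset vspace)
}.

Definition graph_of (G : graphOnBorel) : graph := Graph (@bedge G).
Coercion graph_of : graphOnBorel >-> graph.

Definition is_borel_graph (R : realType) (G : graphOnBorel) : Prop :=
  standard_borel R (vspace G) /\
  @borel (two_subset_borel (vspace G)) (@bedge G).

Definition borel_isomorphic (G H : graphOnBorel) : Prop :=
  exists2 f : vspace G -> vspace H, @graph_iso G H f & borel_fun f.

Definition borel_line (G : graphOnBorel) : graphOnBorel :=
  @GraphOnBorel (@subspace_borel (two_subset_borel (vspace G)) (@bedge G))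
    (@line_edge _ (@bedge G)).

Definition is_borel_line_graph (R : realType) (L : graphOnBorel) : Prop :=
  is_borel_graph R L /\
  exists2 G : graphOnBorel, is_borel_graph R G & borel_isomorphic L (borel_line G).

Definition borel_colorable (G : graphOnBorel) (X : borelSpace) : Prop :=
  exists2 f : vspace G -> X,
    borel_fun f & forall x y : vspace G, @adj G x y -> f x <> f y.

(* The cardinality of [X] is the Borel chromatic number of [G]. *)
Definition borel_chromatic_number (R : realType) (G : graphOnBorel)
    (X : borelSpace) : Prop :=
  [/\ standard_borel R X, borel_colorable G X &
      forall Y : borelSpace, standard_borel R Y -> borel_colorable G Y ->
        [set: X] #<= [set: Y]].

Definition borel_chromatic_number_le_aleph0 (R : realType)
    (G : graphOnBorel) : Prop :=
  exists2 X : borelSpace, borel_chromatic_number R G X & [set: X] #<= [set: nat].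

(* Main.v *)
From HB Require Import structures.
Require Import Defs.
From mathcomp Require Import all_boot all_order all_algebra.
From mathcomp Require Import all_classical all_reals all_analysis.
From mathcomp Require Import lra.

Set Implicit Arguments.
Unset Strict Implicit.
Unset Printing Implicit Defensive.

(* A root graph of [L] amounts to a choice of which triangles of [L] are stars,
   that is, consist of edges of the root graph with a common endpoint.  If some
   vertex of [L] is adjacent to an odd number of members of a triangle, the
   triangle must be a star, and conversely, except in components contained in the
   line graph of the complete graph on four vertices, where a Borel tournament on
   the vertices of [L] selects one of the two solutions.  Hence the stars are
   Borel definable by quantifying over neighbours.

   Line graphs are claw-free, so a vertex has at most two neighbours of each
   colour.  Lusin's separation theorem makes relations with singleton sections
   Borel uniformizable, and so the neighbours of [x] are enumerated by countably
   many Borel functions of [x], which turns quantifiers over neighbours into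
   countable unions and intersections.

   Every vertex [x] of [L] has two ends [(x, false)] and [(x, true)].  A vertex
   of the root graph is a maximal set of ends in a common star; its members have
   distinct colours, so the end of least colour represents it.  The Borel root
   graph lives on all ends, those which represent nothing being isolated. *)

(** * Stars in line graphs *)

Section LineGraph.
Variables (X : eqType) (A : rel X).

Definition is_triangle x y z := [&& A x y, A y z & A x z].

Definition odd_triple x y z :=
  `[< exists w, A w x (+) A w y (+) A w z >].

Definition exceptional x y z :=
  [&& ~~ odd_triple x y z,
     `[< forall w, A w x -> A w y -> ~~ odd_triple x y w >],
     `[< forall w, A w y -> A w z -> ~~ odd_triple y z w >] &
     `[< forall w, A w x -> A w z -> ~~ odd_triple x z w >]].

Variable lt : rel X.

(** Inside an octahedron a non-neighbour [x'] sharing a neighbour [y] with [x] can only be the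
    antipode of [x], so this bit singles out one vertex of such an antipodal pair. *)
Definition above_antipode x :=
  `[< exists x' y, [&& x' != x, ~~ A x' x, A y x, A y x' & lt x' x] >].

(* The triangles of [L] whose vertices, seen as edges of a root graph, share an
   endpoint.  An odd triangle has to be one.  If a triangle that is not odd shares
   no edge with an odd one, its component embeds in the line graph of the complete
   graph on four vertices; there exactly one of two triangles with a common edge
   is a star, and the parity below alternates in the same way, because the
   vertices not on the common edge are each other's antipodes. *)
Definition star x y z :=
  is_triangle x y z &&
  (odd_triple x y z ||
   exceptional x y z &&
   ~~ (above_antipode x (+) above_antipode y (+) above_antipode z)).

Hypothesis A_sym : symmetric A.
Hypothesis A_irr : irreflexive A.

Lemma odd_triple12 x y z : odd_triple x y z = odd_triple y x z.
Proof.
by apply: asbool_equiv_eq; split=> -[w Hw]; exists w; rewrite (addbC (A w _)).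
Qed.

Lemma odd_triple23 x y z : odd_triple x y z = odd_triple x z y.
Proof. by apply: asbool_equiv_eq; split=> -[w Hw]; exists w; rewrite addbAC. Qed.

Lemma exceptional12 x y z : exceptional x y z = exceptional y x z.
Proof.
rewrite /exceptional (odd_triple12 x y); congr (_ && _).
rewrite -!asbool_and; apply: asbool_equiv_eq; split=> -[h1 [h2 h3]]; do ?split => //.
- by move=> w wy wx; rewrite odd_triple12 h1.
- by move=> w wx wy; rewrite odd_triple12 h1.
Qed.

Lemma exceptional23 x y z : exceptional x y z = exceptional x z y.
Proof.
rewrite /exceptional (odd_triple23 x y); congr (_ && _).
rewrite -!asbool_and; apply: asbool_equiv_eq; split=> -[h1 [h2 h3]]; do ?split => //.
- by move=> w wy wx; rewrite odd_triple12 h2.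
- by move=> w wx wy; rewrite odd_triple12 h2.
Qed.

Lemma is_triangle12 x y z : is_triangle x y z = is_triangle y x z.
Proof. by rewrite /is_triangle (A_sym y x) (andbC (A x z)). Qed.

Lemma is_triangle23 x y z : is_triangle x y z = is_triangle x z y.
Proof. by rewrite /is_triangle (A_sym z y); do 3!case: (A _ _). Qed.

Lemma star12 x y z : star x y z = star y x z.
Proof.
by rewrite /star is_triangle12 odd_triple12 exceptional12
  (addbC (above_antipode x)).
Qed.

Lemma star23 x y z : star x y z = star x z y.
Proof.
by rewrite /star is_triangle23 odd_triple23 exceptional23 addbAC.
Qed.

(** On the six vertices [0] to [5] the antipode of [i] is [5 - i]. *)
Definition octahedron (i j : nat) := (i != j) && (i + j != 5).

(* A component of [L] embedded in the octahedron, which is the line graph of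
   the complete graph on four vertices. *)
Definition octahedral (D : pred X) (g : X -> nat) :=
  [/\ forall u w, A u w -> D u -> D w,
      forall u, D u -> g u < 6,
      forall u w, D u -> D w -> g u = g w -> u = w &
      forall u w, D u -> D w -> A u w = octahedron (g u) (g w)].

Definition octahedral_triple x y z :=
  exists D g, octahedral D g /\ [/\ D x, D y & D z].

(** A triangle takes one vertex from each antipodal pair. A vertex [l] is thus a member or the
    antipode of a member, and in both cases adjacent to exactly the other two. The proof evaluates
    all cases. *)
Lemma octahedron_even i j k l : i < 6 -> j < 6 -> k < 6 -> l < 6 ->
  octahedron i j -> octahedron j k -> octahedron i k ->
  ~~ (octahedron l i (+) octahedron l j (+) octahedron l k).
Proof.
move=> hi hj hk hl.
have : all (fun i => all (fun j => all (fun k => all (fun l =>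
  [&& octahedron i j, octahedron j k & octahedron i k] ==>
  ~~ (octahedron l i (+) octahedron l j (+) octahedron l k))
  (iota 0 6)) (iota 0 6)) (iota 0 6)) (iota 0 6) by [].
have io n : n < 6 -> n \in iota 0 6 by rewrite mem_iota.
by move=> /allP/(_ i (io _ hi))/allP/(_ j (io _ hj))/allP/(_ k (io _ hk))/allP
  /(_ l (io _ hl))/implyP H ij jk ik; apply: H; rewrite ij jk.
Qed.

Lemma octahedral_even D g x y z : octahedral D g -> D x -> D y -> D z ->
  is_triangle x y z -> ~~ odd_triple x y z.
Proof.
move=> [cl lt6 inj AE] Dx Dy Dz /and3P[xy yz xz]; apply/asboolPn => -[w].
have [Dw|nDw] := boolP (D w).
  rewrite !AE//; apply/negP/octahedron_even; rewrite -?AE ?lt6//.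
have nD u : D u -> A w u = false.
  by move=> Du; apply: contraNF nDw; rewrite A_sym => /cl; exact.
by rewrite !nD.
Qed.

Lemma octahedral_exceptional D g x y z : octahedral D g ->
  D x -> D y -> D z -> is_triangle x y z -> exceptional x y z.
Proof.
move=> oct Dx Dy Dz xyz; have := oct => -[cl _ _ _]; rewrite /exceptional.
rewrite (octahedral_even oct)//=; move: xyz => /and3P[xy yz xz].
apply/and3P; split; apply/asboolP => w w1 w2;
  (have Dw : D w by move: (w1); rewrite A_sym => /cl; auto);
  apply: (octahedral_even oct) => //;
  by rewrite /is_triangle ?[A _ w]A_sym w1 w2 ?xy ?yz ?xz.
Qed.

Lemma octahedral_star D g x y z : octahedral D g ->
  D x -> D y -> D z -> is_triangle x y z ->
  star x y z =
    ~~ (above_antipode x (+) above_antipode y (+) above_antipode z).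
Proof.
move=> oct Dx Dy Dz t; rewrite /star t (octahedral_exceptional oct)//.
by rewrite (negbTE (octahedral_even oct _ _ _ t)).
Qed.


Hypothesis lt_tournament : forall x y, x != y -> lt x y = ~~ lt y x.

Lemma octahedral_opposite D g x a c : octahedral D g -> D x ->
  A x a -> A x c -> a != c -> ~~ A a c -> g a + g c = 5.
Proof.
move=> [cl lt6 inj AE] Dx xa xc ac; have Da := cl _ _ xa Dx.
have Dc := cl _ _ xc Dx; rewrite AE// /octahedron negb_and !negbK.
by case/orP => /eqP// /inj => /(_ Da Dc) ca; rewrite ca eqxx in ac.
Qed.

Lemma octahedral_above D g x a c : octahedral D g -> D x ->
  A x a -> A x c -> a != c -> ~~ A a c ->
  above_antipode a = lt c a.
Proof.
move=> oct Dx xa xc ac nac; have := oct => -[cl lt6 inj AE].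
have Da := cl _ _ xa Dx; have Dc := cl _ _ xc Dx.
apply/asboolP/idP => [[a' [y /and5P[a'a na'a ya ya' h]]]|h]; last first.
  by exists c, x; rewrite eq_sym ac xa xc h A_sym nac.
have Dy : D y by apply: cl Da; rewrite A_sym.
have Da' := cl _ _ ya' Dy.
have := octahedral_opposite oct Dx xa xc ac nac.
rewrite -(octahedral_opposite oct Dy ya' ya a'a na'a) addnC => /addIn /inj.
by move=> /(_ Dc Da') ->.
Qed.

Lemma octahedral_flip D g x a c : octahedral D g -> D x ->
  A x a -> A x c -> a != c -> ~~ A a c ->
  above_antipode a = ~~ above_antipode c.
Proof.
move=> oct Dx xa xc ac nac; rewrite (octahedral_above oct Dx xa xc ac nac).
by rewrite (octahedral_above oct Dx xc xa) 1?eq_sym// 1?A_sym// lt_tournament// eq_sym.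
Qed.

(** The neighbours of [h] form a 4-cycle, and three vertices of a 4-cycle are an antipodal pair and
    a vertex adjacent to both. *)
Lemma octahedron_three h i j k : h < 6 -> i < 6 -> j < 6 -> k < 6 ->
  octahedron h i -> octahedron h j -> octahedron h k ->
  i != j -> j != k -> i != k ->
  [|| [&& i + j == 5, octahedron i k & octahedron j k],
      [&& j + k == 5, octahedron i j & octahedron i k] |
      [&& i + k == 5, octahedron i j & octahedron j k]].
Proof.
move=> hh hi hj hk.
have : all (fun h => all (fun i => all (fun j => all (fun k =>
  [&& octahedron h i, octahedron h j, octahedron h k, i != j, j != k & i != k] ==>
  [|| [&& i + j == 5, octahedron i k & octahedron j k],
      [&& j + k == 5, octahedron i j & octahedron i k] |
      [&& i + k == 5, octahedron i j & octahedron j k]])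
  (iota 0 6)) (iota 0 6)) (iota 0 6)) (iota 0 6) by [].
have io n : n < 6 -> n \in iota 0 6 by rewrite mem_iota.
move=> /allP/(_ h (io _ hh))/allP/(_ i (io _ hi))/allP/(_ j (io _ hj))/allP.
move=> /(_ k (io _ hk))/implyP H h1 h2 h3 h4 h5 h6; apply: H.
by rewrite h1 h2 h3 h4 h5 h6.
Qed.

Lemma octahedral_star_flip D g x a c b : octahedral D g -> D x ->
  A x a -> A x c -> a != c -> ~~ A a c -> A x b -> A a b -> A c b ->
  star x a b = ~~ star x c b.
Proof.
move=> oct Dx xa xc ac nac xb ab cb; have := oct => -[cl lt6 inj AE].
have Da := cl _ _ xa Dx; have Dc := cl _ _ xc Dx; have Db := cl _ _ xb Dx.
rewrite !(octahedral_star oct) /is_triangle ?xa ?xb ?xc ?ab ?cb//.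
rewrite (octahedral_flip oct Dx xa xc ac nac).
by do 3!case: above_antipode.
Qed.

Lemma octahedral_antipodes D g x a b c : octahedral D g -> D x ->
  A x a -> A x b -> A x c -> a != b -> b != c -> a != c ->
  [\/ [/\ ~~ A a b, A a c & A b c],
      [/\ ~~ A b c, A a b & A a c] |
      [/\ ~~ A a c, A a b & A b c]].
Proof.
move=> [cl lt6 inj AE] Dx xa xb xc ab bc ac.
have Da := cl _ _ xa Dx; have Dc := cl _ _ xc Dx; have Db := cl _ _ xb Dx.
have gne u v : D u -> D v -> u != v -> g u != g v.
  by move=> Du Dv; apply: contra_neq => /inj; exact.
move: xa xb xc; rewrite !AE// => xa xb xc.
have := octahedron_three (lt6 _ Dx) (lt6 _ Da) (lt6 _ Db) (lt6 _ Dc) xa xb xc.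
rewrite !gne// => /(_ isT isT isT) /or3P[] /and3P[/eqP e h1 h2].
- by constructor 1; rewrite {1}/octahedron e eqxx andbF.
- by constructor 2; rewrite {1}/octahedron e eqxx andbF.
- by constructor 3; rewrite {1}/octahedron e eqxx andbF.
Qed.

(** The premises contradict each other: two of the three neighbours of [x] are antipodal,
    necessarily [a] and [c], and then exactly one of the two triangles on the edge [x b] is a
    star. *)
Lemma octahedral_star_trans D g x a b c : octahedral D g -> D x ->
  a != c -> star x a b -> star x b c -> star x a c.
Proof.
move=> oct Dx ac xab xbc.
have /andP[/and3P[xa ab xb] _] := xab.
have /andP[/and3P[_ bc xc] _] := xbc.
have neq u v : A u v -> u != v by apply: contraTneq => ->; rewrite A_irr.
have [[]|[]|[nac _ _]] := octahedral_antipodes oct Dx xa xb xc (neq _ _ ab) (neq _ _ bc) ac.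
- by rewrite ab.
- by rewrite bc.
have := octahedral_star_flip oct Dx xa xc ac nac xb ab; rewrite A_sym => /(_ bc).
by rewrite xab (star23 x c) xbc.
Qed.

Lemma octahedral_star_two D g x a b c : octahedral D g -> D x ->
  A x a -> A x b -> A x c -> a != b -> b != c -> a != c ->
  [|| star x a b, star x b c | star x a c].
Proof.
move=> oct Dx xa xb xc ab bc ac.
have [[nab h1 h2]|[nbc h1 h2]|[nac h1 h2]] := octahedral_antipodes oct Dx xa xb xc ab bc ac.
- by have -> := octahedral_star_flip oct Dx xa xb ab nab xc h1 h2;
    case: (star x b c); rewrite ?orbT.
- have := octahedral_star_flip oct Dx xb xc bc nbc xa; rewrite ![A _ a]A_sym => /(_ h1 h2).
  by rewrite (star23 x b a) (star23 x c a) => ->; case: (star x a c); rewrite ?orbT.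
- have := octahedral_star_flip oct Dx xa xc ac nac xb h1; rewrite (A_sym c b) => /(_ h2) ->.
  by rewrite (star23 x c b); case: (star x b c).
Qed.

End LineGraph.

(** * Incidences in a root graph *)

Section RootGraph.
Variables (X V : eqType) (p q : X -> V).
Hypothesis pq_neq : forall x, p x != q x.

Definition inc x v := (p x == v) || (q x == v).

Hypothesis inc_inj : forall x y, inc x =1 inc y -> x = y.

Variable A : rel X.
(** In a simple graph, edges sharing both endpoints are equal, so adjacency in the line graph means
    sharing exactly one endpoint. The exclusive or makes parity computations over incidences
    possible. *)
Hypothesis adjE : forall x y, A x y = inc x (p y) (+) inc x (q y).

Definition ends x a b := (a != b) && inc x a && inc x b.

Lemma ends_inc x a b : ends x a b -> forall v, inc x v = (v == a) || (v == b).
Proof.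
move=> /andP[/andP[ab]] /[swap] ib ia v; rewrite /inc ![v == _]eq_sym.
move: ia ib ab (pq_neq x); rewrite /inc.
do 2!case/orP => /eqP <-; rewrite ?eqxx// => _ _.
by rewrite orbC.
Qed.

Lemma ends_sym x a b : ends x a b = ends x b a.
Proof. by rewrite /ends eq_sym -!andbA (andbC (inc x a)). Qed.

Lemma ends_inj x y a b : ends x a b -> ends y a b -> x = y.
Proof. by move=> xab yab; apply: inc_inj => v; rewrite !(@ends_inc _ a b). Qed.

Lemma ends_pq x : ends x (p x) (q x).
Proof. by rewrite /ends /inc pq_neq !eqxx orbT. Qed.

Lemma inc_ends x v : inc x v -> exists a, ends x v a.
Proof.
move=> /orP[] /eqP <-; first by exists (q x); exact: ends_pq.
by exists (p x); rewrite ends_sym ends_pq.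
Qed.

Lemma ends_neq x a b : ends x a b -> a != b.
Proof. by move=> /andP[/andP[]]. Qed.

Lemma ends_adj w x a b : ends x a b -> A w x = inc w a (+) inc w b.
Proof.
move=> xab; rewrite adjE; have := ends_pq x; rewrite /ends !(ends_inc xab).
move=> /andP[/andP[+ /orP[]/eqP e1] /orP[]/eqP e2]; rewrite e1 e2 ?eqxx// => _.
by rewrite addbC.
Qed.

Lemma root_adj_irr : irreflexive A.
Proof. by move=> x; rewrite adjE /inc !eqxx orbT. Qed.

Lemma root_adj_sym : symmetric A.
Proof.
move=> x y; rewrite !adjE /inc.
have n (a b c : V) : b != c -> ~~ ((b == a) && (c == a)).
  by apply: contra => /andP[/eqP -> /eqP ->].
have := n (p x) _ _ (pq_neq y); have := n (q x) _ _ (pq_neq y).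
have := n (p y) _ _ (pq_neq x); have := n (q y) _ _ (pq_neq x).
rewrite ![_ == p x]eq_sym ![_ == q x]eq_sym.
by do 4!case: (_ == _).
Qed.

Lemma adj_ends x y : A x y ->
  exists v a b, [/\ ends x v a, ends y v b & a != b].
Proof.
move=> xy; have : exists2 v, inc x v & inc y v.
  move: (xy); rewrite (ends_adj x (ends_pq y)).
  have [py _|_ /= qy] := boolP (inc x (p y)).
  - by exists (p y) => //; rewrite /inc eqxx.
  - by exists (q y) => //; rewrite /inc eqxx orbT.
move=> [v /inc_ends[a xva] /inc_ends[b yvb]]; exists v, a, b; split => //.
apply: contraTneq xy => ab; rewrite ab in xva.
by rewrite (ends_inj xva yvb) root_adj_irr.
Qed.

(** If [z] passes through the vertex common to [x] and [y], the three edges form a star; otherwise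
    [z] joins the other endpoints of [x] and [y], and the root graph has a triangle. *)
Lemma triangle_ends x y z : is_triangle A x y z ->
  (exists v a b c, uniq [:: v; a; b; c] /\
     [/\ ends x v a, ends y v b & ends z v c]) \/
  (exists u v w, uniq [:: u; v; w] /\
     [/\ ends x u v, ends y v w & ends z u w]).
Proof.
move=> /and3P[xy yz xz]; have [v [a [b [xva yvb ab]]]] := adj_ends xy.
have va := ends_neq xva; have vb := ends_neq yvb.
move: xz yz; rewrite ![A _ z]root_adj_sym (ends_adj z xva) (ends_adj z yvb).
have [/inc_ends[c zvc]|zv] := boolP (inc z v) => /=.
  rewrite !(ends_inc zvc) ![_ == v]eq_sym (negbTE va) (negbTE vb) /= => ac bc.
  left; exists v, a, b, c; split => //=.
  by rewrite !inE !negb_or va vb ab ac bc (ends_neq zvc).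
move=> za zb; right; exists a, v, b; split.
  by rewrite /= !inE !negb_or ab vb eq_sym va.
by split; [rewrite ends_sym| |rewrite /ends ab za zb].
Qed.

(** An edge meets the four vertices in at most two of its endpoints, so even parity says that no
    edge leaves the set. Not all six edges have to be present. *)
Definition K4_component v a b c := uniq [:: v; a; b; c] /\
  forall w, ~~ (inc w v (+) inc w a (+) inc w b (+) inc w c).

Definition K4_touch v a b c u := [|| inc u v, inc u a, inc u b | inc u c].

Lemma inc_three x u v w : uniq [:: u; v; w] ->
  inc x u -> inc x v -> inc x w = false.
Proof.
rewrite /= !inE negb_or andbT => /andP[/andP[uv uw] vw] xu xv.
have xuv : ends x u v by rewrite /ends uv xu xv.
by rewrite (ends_inc xuv) ![w == _]eq_sym (negbTE uw) (negbTE vw).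
Qed.

Lemma K4_ends v a b c u : K4_component v a b c -> K4_touch v a b c u ->
  [\/ ends u v a, ends u v b | ends u v c] \/
  [\/ ends u a b, ends u a c | ends u b c].
Proof.
move=> [uq /(_ u)]; rewrite /K4_touch.
have := uq; rewrite /= !inE !negb_or andbT.
move=> /andP[/and3P[va vb vc] /andP[/andP[ab ac] bc]].
have vab : uniq [:: v; a; b] by rewrite /= !inE !negb_or va vb ab.
have vac : uniq [:: v; a; c] by rewrite /= !inE !negb_or va vc ac.
have vbc : uniq [:: v; b; c] by rewrite /= !inE !negb_or vb vc bc.
have abc : uniq [:: a; b; c] by rewrite /= !inE !negb_or ab ac bc.
have := @inc_three u _ _ _ vab; have := @inc_three u _ _ _ vac.
have := @inc_three u _ _ _ vbc; have := @inc_three u _ _ _ abc.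
rewrite /ends va vb vc ab ac bc /=.
case: (inc u v); case: (inc u a); case: (inc u b); case: (inc u c) => //= h1 h2 h3 h4 _ _;
 try (by have := h1 isT isT); try (by have := h2 isT isT);
 try (by have := h3 isT isT); try (by have := h4 isT isT);
 by [left; constructor 1|left; constructor 2|left; constructor 3|
     right; constructor 1|right; constructor 2|right; constructor 3].
Qed.

(** Disjoint edges receive codes with sum [5], in agreement with the antipodes of [octahedron]. *)
Definition K4_code v a b (c : V) u :=
  if inc u v then if inc u a then 0 else if inc u b then 1 else 2
  else if inc u a then if inc u b then 3 else 4 else 5.

Variant K4_spec v a b c u : nat -> Prop :=
| K4_va of ends u v a : K4_spec v a b c u 0
| K4_vb of ends u v b : K4_spec v a b c u 1
| K4_vc of ends u v c : K4_spec v a b c u 2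
| K4_ab of ends u a b : K4_spec v a b c u 3
| K4_ac of ends u a c : K4_spec v a b c u 4
| K4_bc of ends u b c : K4_spec v a b c u 5.

Lemma uniq4E (T : eqType) (v a b c : T) : uniq [:: v; a; b; c] ->
  ((v == a) = false) * ((v == b) = false) * ((v == c) = false) *
  ((a == b) = false) * ((a == c) = false) * ((b == c) = false) *
  ((a == v) = false) * ((b == v) = false) * ((c == v) = false) *
  ((b == a) = false) * ((c == a) = false) * ((c == b) = false).
Proof.
rewrite /= !inE !negb_or andbT => /andP[/and3P[va vb vc] /andP[/andP[ab ac] bc]].
rewrite (eq_sym a v) (eq_sym b v) (eq_sym c v) (eq_sym b a) (eq_sym c a) (eq_sym c b).
by do ![split]; exact/negbTE.
Qed.

Lemma K4P v a b c u : K4_component v a b c -> K4_touch v a b c u ->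
  K4_spec v a b c u (K4_code v a b c u).
Proof.
move=> K Du; have N := uniq4E K.1; rewrite /K4_code.
case: (K4_ends K Du) => -[] e; rewrite !(ends_inc e) !N !eqxx /=.
- exact: K4_va.
- exact: K4_vb.
- exact: K4_vc.
- exact: K4_ab.
- exact: K4_ac.
- exact: K4_bc.
Qed.

Lemma K4_octahedral v a b c : K4_component v a b c ->
  octahedral A (K4_touch v a b c) (K4_code v a b c).
Proof.
move=> K; have N := uniq4E K.1; split.
- move=> u w uw Du; have : A w u by rewrite root_adj_sym.
  case: (K4P K Du) => ui; rewrite (ends_adj _ ui) /K4_touch;
    by do 4!case: (inc w _).
- by move=> u Du; case: (K4P K Du).
- move=> u w Du Dw; case: (K4P K Du) => ui; case: (K4P K Dw) => // wj _;
    exact: ends_inj ui wj.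
- move=> u w Du Dw; case: (K4P K Du) => ui; case: (K4P K Dw) => wj;
    by rewrite (ends_adj _ wj) !(ends_inc ui) ?N ?eqxx.
Qed.

Lemma inc_adj x y v : x != y -> inc x v -> inc y v -> A x y.
Proof.
move=> xy /inc_ends[a xva] /inc_ends[b yvb]; rewrite (ends_adj _ yvb).
rewrite !(ends_inc xva) eqxx /= negb_or [b == v]eq_sym (ends_neq yvb) /=.
by apply: contra_neqN xy => /eqP ba; rewrite ba in yvb; exact: ends_inj xva yvb.
Qed.

(** In the sum of the three adjacencies of [w] the term [inc w v] occurs three times, which leaves
    exactly the parity in [K4_component]. *)
Lemma concurrent_even_K4 x y z v a b c : uniq [:: v; a; b; c] ->
  ends x v a -> ends y v b -> ends z v c -> ~~ odd_triple A x y z ->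
  K4_component v a b c.
Proof.
move=> uq xva yvb zvc /asboolPn ev; split => // w; apply/negP => h.
apply: ev; exists w; move: h.
rewrite (ends_adj _ xva) (ends_adj _ yvb) (ends_adj _ zvc).
by do 4!case: (inc w _).
Qed.

(** Each of [u], [v], [w] lies on two of the three edges, so all incidence terms cancel. *)
Lemma triangle_even x y z u v w :
  ends x u v -> ends y v w -> ends z u w -> ~~ odd_triple A x y z.
Proof.
move=> xuv yvw zuw; apply/asboolPn => -[t].
rewrite (ends_adj _ xuv) (ends_adj _ yvw) (ends_adj _ zuw).
by do 3!case: (inc t _).
Qed.

Lemma K4_touchT v a b c x s t : ends x s t -> s \in [:: v; a; b; c] ->
  K4_touch v a b c x.
Proof.
move=> /andP[/andP[_ xs] _]; rewrite !inE /K4_touch.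
by case/or4P => /eqP <-; rewrite xs ?orbT.
Qed.

(** A third edge [t] at [u], with other endpoint [s], forms a star with [x] and [z]. If that star is
    not odd, [concurrent_even_K4] applies to [u], [v], [w], [s]. *)
Lemma pendant_K4 x z t u v w : uniq [:: u; v; w] ->
  ends x u v -> ends z u w -> inc t u -> t != x -> t != z ->
  (A t x -> A t z -> ~~ odd_triple A x z t) ->
  exists s, K4_component u v w s.
Proof.
move=> uq xuv zuw tu tx tz ev; have /inc_ends[s tus] := tu; exists s.
apply: (concurrent_even_K4 _ xuv zuw tus); last first.
  by apply: ev; apply: (@inc_adj _ _ u) => //; rewrite (ends_inc xuv, ends_inc zuw) eqxx.
have sv : v != s by apply: contra_neq tx => e; rewrite -e in tus; exact: ends_inj tus xuv.
have sw : w != s by apply: contra_neq tz => e; rewrite -e in tus; exact: ends_inj tus zuw.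
move: uq; rewrite /= !inE !negb_or !andbT => /andP[/andP[-> ->] ->].
by rewrite (ends_neq tus) sv sw.
Qed.

Lemma K4_octahedral_triple v a b c x y z : K4_component v a b c ->
  K4_touch v a b c x -> K4_touch v a b c y -> K4_touch v a b c z ->
  octahedral_triple A x y z.
Proof.
by move=> K xK yK zK; exists (K4_touch v a b c), (K4_code v a b c);
  split; [exact: K4_octahedral|].
Qed.

Lemma exceptional_octahedral x y z : is_triangle A x y z ->
  exceptional A x y z -> octahedral_triple A x y z.
Proof.
move=> t /and4P[ev /asboolP exy /asboolP eyz /asboolP exz].
have [[v [a [b [c [uq [xva yvb zvc]]]]]]|[u [v [w [uq [xuv yvw zuw]]]]]] := triangle_ends t.
  apply: (K4_octahedral_triple (concurrent_even_K4 uq xva yvb zvc ev));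
    [apply: K4_touchT xva _|apply: K4_touchT yvb _|apply: K4_touchT zvc _];
    by rewrite mem_head.
(* The edges form a triangle of the root graph. A further edge at a corner forms a star sharing a
   line graph edge with this triangle, and exceptionality makes that star even. *)
have [[s [sn si]]|ns] := pselect (exists s,
    s \notin [:: x; y; z] /\ [|| inc s u, inc s v | inc s w]).
  move: sn; rewrite !inE !negb_or => /and3P[sx sy sz].
  have vuw : uniq [:: v; u; w].
    by move: uq; rewrite /= !inE !negb_or [u == v]eq_sym => /and3P[/andP[-> ->] ->].
  have wvu : uniq [:: w; v; u].
    by move: uq; rewrite -rev_uniq.
  case/or3P: si => si.
  - have [r K] := pendant_K4 uq xuv zuw si sx sz (exz s).
    apply: (K4_octahedral_triple K);
    [apply: K4_touchT xuv _|apply: K4_touchT yvw _|apply: K4_touchT zuw _];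
    by rewrite !inE eqxx ?orbT.
  - rewrite ends_sym in xuv; have [r K] := pendant_K4 vuw xuv yvw si sx sy (exy s).
    apply: (K4_octahedral_triple K);
    [apply: K4_touchT xuv _|apply: K4_touchT yvw _|apply: K4_touchT zuw _];
    by rewrite !inE eqxx ?orbT.
  - rewrite ends_sym in yvw; rewrite ends_sym in zuw.
    have [r K] := pendant_K4 wvu yvw zuw si sy sz (eyz s).
    apply: (K4_octahedral_triple K);
    [apply: K4_touchT xuv _|apply: K4_touchT yvw _|apply: K4_touchT zuw _];
    by rewrite !inE eqxx ?orbT.
have /and3P[xy yz xz] := t.
have neq r r' : A r r' -> (r == r') = false.
  by move=> h; apply/negbTE; apply: contraTneq h => ->; rewrite root_adj_irr.
have yx := xy; have zy := yz; have zx := xz.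
rewrite root_adj_sym in yx; rewrite root_adj_sym in zy; rewrite root_adj_sym in zx.
have N := (neq _ _ xy, neq _ _ yz, neq _ _ xz, neq _ _ yx, neq _ _ zy, neq _ _ zx).
(* No other edge touches the triangle, which is therefore a whole component; among the codes [0],
   [1], [2] no two add up to [5]. *)
exists (mem [:: x; y; z]), (fun r => if r == x then 0 else if r == y then 1 else 2).
split; last by rewrite !inE !eqxx !orbT.
split.
- move=> r s; rewrite root_adj_sym => rs rD; apply: contrapT => /negP sD; apply: ns.
  exists s; split => //; move: rD rs; rewrite /= !inE.
  by case/or3P => /eqP ->; rewrite (ends_adj _ xuv, ends_adj _ yvw, ends_adj _ zuw);
    do 3!case: (inc s _).
- by move=> r _; case: ifP => // _; case: ifP.
- move=> r s; rewrite /= !inE.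
  by case/or3P => /eqP ->; case/or3P => /eqP ->; rewrite ?eqxx ?N.
- move=> r s; rewrite /= !inE.
  by case/or3P => /eqP ->; case/or3P => /eqP ->;
    rewrite ?root_adj_irr ?eqxx ?N.
Qed.

Variable lt : rel X.
Hypothesis lt_tournament : forall x y, x != y -> lt x y = ~~ lt y x.

(** Outside octahedral components nothing is exceptional, so [star] reduces to oddness. A concurrent
    triangle that is not odd would span a [K4_component], and a root triangle is never odd. *)
Lemma star_concurrent x y z :
  ~ (exists D g, octahedral A D g /\ D x) -> is_triangle A x y z ->
  star A lt x y z <-> exists v, [/\ inc x v, inc y v & inc z v].
Proof.
move=> no t; rewrite /star t /=.
have -> : exceptional A x y z = false.
  apply: contra_notF no => /(exceptional_octahedral t)[D [g [oct [Dx _ _]]]].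
  by exists D, g.
rewrite /= orbF.
have [[v [a [b [c [uq [xva yvb zvc]]]]]]|[u [v [w [uq [xuv yvw zuw]]]]]] := triangle_ends t.
  split=> _.
    by exists v; rewrite (ends_inc xva) (ends_inc yvb) (ends_inc zvc) !eqxx.
  apply: contrapT => /negP ev; apply: no.
  exists (K4_touch v a b c), (K4_code v a b c).
  have K := concurrent_even_K4 uq xva yvb zvc ev.
  by split; [exact: K4_octahedral|apply: K4_touchT xva _; exact: mem_head].
rewrite (negbTE (triangle_even xuv yvw zuw)); split=> // -[r []].
rewrite (ends_inc xuv) (ends_inc yvw) (ends_inc zuw).
move: uq; rewrite /= !inE negb_or andbT => /andP[/andP[uv uw] vw].
case/orP => /eqP ->; rewrite eqxx ?(negbTE uv) ?(negbTE uw) ?(negbTE vw) //=.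
by rewrite [v == u]eq_sym (negbTE uv).
Qed.

(** Outside the octahedral case, the endpoint shared by [x], [a], [b] and the one shared by [x],
    [b], [c] coincide, because the distinct edges [x] and [b] have only one common endpoint. *)
Lemma star_trans x a b c : a != c ->
  star A lt x a b -> star A lt x b c -> star A lt x a c.
Proof.
have [[D [g [oct Dx]]]|no] := pselect (exists D g, octahedral A D g /\ D x).
  exact: (octahedral_star_trans root_adj_sym root_adj_irr lt_tournament oct Dx).
move=> ac sab sbc.
have /andP[tab _] := sab; have /andP[tbc _] := sbc.
have [u [xu au bu]] := (star_concurrent no tab).1 sab.
have [v [xv bv cv]] := (star_concurrent no tbc).1 sbc.
have /and3P[xa ab xb] := tab; have /and3P[_ bc xc] := tbc.
have uv : u = v.
  apply/eqP; apply: contraTT xb => uv.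
  have xuv : ends x u v by rewrite /ends uv xu xv.
  have buv : ends b u v by rewrite /ends uv bu bv.
  by rewrite (ends_inj xuv buv) root_adj_irr.
rewrite -{}uv in cv.
have tac : is_triangle A x a c by rewrite /is_triangle xa xc (inc_adj ac au cv).
by apply/(star_concurrent no tac); exists u.
Qed.

(** Pigeonhole: each of the three neighbours contains [p x] or [q x], so two of them meet [x] in the
    same endpoint. The octahedral case follows from the alternation of stars on a common edge. *)
Lemma star_two x a b c : A x a -> A x b -> A x c ->
  a != b -> b != c -> a != c ->
  [|| star A lt x a b, star A lt x b c | star A lt x a c].
Proof.
have [[D [g [oct Dx]]]|no] := pselect (exists D g, octahedral A D g /\ D x).
  exact: (octahedral_star_two root_adj_sym lt_tournament oct Dx).
move=> xa xb xc ab bc ac.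
have S v r s : A x r -> A x s -> r != s -> inc x v -> inc r v -> inc s v -> star A lt x r s.
  move=> xr xs rs xv rv sv; apply/star_concurrent => //; last by exists v.
  by rewrite /is_triangle xr xs (inc_adj rs rv sv).
have P r : A x r -> inc r (p x) || inc r (q x).
  by rewrite root_adj_sym (ends_adj _ (ends_pq x)); do 2!case: (inc r _).
have xp : inc x (p x) by rewrite /inc eqxx.
have xq : inc x (q x) by rewrite /inc eqxx orbT.
case/orP: (P _ xa) => pa; case/orP: (P _ xb) => pb; case/orP: (P _ xc) => pc.
all: first
  [ by rewrite (S _ _ _ xa xb ab xp pa pb) | by rewrite (S _ _ _ xa xb ab xq pa pb)
  | by rewrite (S _ _ _ xb xc bc xp pb pc) orbT
  | by rewrite (S _ _ _ xb xc bc xq pb pc) orbT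
  | by rewrite (S _ _ _ xa xc ac xp pa pc) !orbT
  | by rewrite (S _ _ _ xa xc ac xq pa pc) !orbT ].
Qed.

Lemma claw_free x a b c : A x a -> A x b -> A x c ->
  a != b -> b != c -> a != c -> [|| A a b, A b c | A a c].
Proof.
move=> xa xb xc ab bc ac.
by case/or3P: (star_two xa xb xc ab bc ac) => /andP[/and3P[_ -> _] _]; rewrite ?orbT.
Qed.

End RootGraph.

Import Order.TTheory GRing.Theory Num.Theory.
Local Open Scope classical_set_scope.

(** * Souslin sets and Lusin separation *)

Section BorelPredicates.
Variable S : borelSpace.
Hypothesis S_sigma : sigma_algebra setT (@borel S).

Lemma borel_notP (P : S -> Prop) : borel P -> borel (fun s => ~ P s).
Proof. by case: S_sigma => _ h _ /h; rewrite setTD. Qed.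

Lemma borel_ext (P Q : S -> Prop) : (forall s, P s <-> Q s) -> borel P -> borel Q.
Proof. by move=> PQ; rewrite (_ : P = Q)//; apply/funext => s; apply/propext. Qed.

Lemma borel_cst (P : Prop) : borel (fun _ : S => P).
Proof.
have [p|np] := pselect P.
  apply: (borel_ext (P := fun s => ~ (set0 : set S) s)) => [s|]; first by split=> // _.
  by apply: (borel_notP (P := set0)); case: S_sigma.
by apply: (borel_ext (P := set0)); case: S_sigma.
Qed.

Lemma borel_exists (I : countType) (P : I -> S -> Prop) :
  (forall i, borel (P i)) -> borel (fun s => exists i, P i s).
Proof.
move=> bP; case: (S_sigma) => _ _ h.
have /h : forall n, borel (fun s => if unpickle n is Some i then P i s else False).
  by move=> n; case: unpickle => [i|]; [exact: bP|exact: borel_cst].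
apply: borel_ext => s; split=> [[n _]|[i Pi]].
  by case: unpickle => // i Pi; exists i.
by exists (pickle i) => //; rewrite pickleK.
Qed.

Lemma borel_forall (I : countType) (P : I -> S -> Prop) :
  (forall i, borel (P i)) -> borel (fun s => forall i, P i s).
Proof.
move=> bP; apply: (borel_ext (P := fun s => ~ exists i, ~ P i s)) => [s|].
  by split=> [/forallNP h i|h [i]//]; apply: contrapT; exact: h.
by apply/borel_notP/borel_exists => i; exact: borel_notP.
Qed.

Lemma borel_and (P Q : S -> Prop) : borel P -> borel Q -> borel (fun s => P s /\ Q s).
Proof.
move=> bP bQ; apply: (borel_ext (P := fun s => forall b : bool, (if b then P else Q) s)).
  by move=> s; split=> [h|[p q] []//]; split; [exact: (h true)|exact: (h false)].
by apply: borel_forall => -[].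
Qed.

Lemma borel_or (P Q : S -> Prop) : borel P -> borel Q -> borel (fun s => P s \/ Q s).
Proof.
move=> bP bQ; apply: (borel_ext (P := fun s => exists b : bool, (if b then P else Q) s)).
  by move=> s; split=> [[[]]|[]] h; [left|right|exists true|exists false].
by apply: borel_exists => -[].
Qed.

Lemma borel_imply (P Q : S -> Prop) : borel P -> borel Q -> borel (fun s => P s -> Q s).
Proof.
move=> bP bQ; apply: (borel_ext (P := fun s => ~ P s \/ Q s)).
  move=> s; split=> [[]//|h].
  by have [/h|] := pselect (P s); [right|left].
by apply: borel_or => //; exact: borel_notP.
Qed.

Lemma borel_iff (P Q : S -> Prop) : borel P -> borel Q -> borel (fun s => P s <-> Q s).
Proof. by move=> bP bQ; apply: borel_and; exact: borel_imply. Qed.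

Lemma borel_negb (P : S -> bool) : borel P -> borel (fun s => ~~ P s).
Proof. by move/borel_notP; apply: borel_ext => s; split=> /negP. Qed.

Lemma borel_andb (P Q : S -> bool) : borel P -> borel Q -> borel (fun s => P s && Q s).
Proof. by move=> p /(borel_and p); apply: borel_ext => s; split=> /andP. Qed.

Lemma borel_orb (P Q : S -> bool) : borel P -> borel Q -> borel (fun s => P s || Q s).
Proof. by move=> p /(borel_or p); apply: borel_ext => s; split=> /orP. Qed.

Lemma borel_addb (P Q : S -> bool) : borel P -> borel Q -> borel (fun s => P s (+) Q s).
Proof.
move=> p q; apply: (borel_ext (P := fun s => P s && ~~ Q s || ~~ P s && Q s)).
  by move=> s; case: (P s); case: (Q s).
by apply: borel_orb; apply: borel_andb => //; exact: borel_negb.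
Qed.

Lemma borel_asbool (P : S -> Prop) : borel P -> borel (fun s => `[< P s >]).
Proof. by apply: borel_ext => s; rewrite asboolE. Qed.

Lemma borel_eqb (P Q : S -> bool) : borel P -> borel Q -> borel (fun s => P s == Q s).
Proof.
move=> p q; apply: (borel_ext (P := fun s => ~~ (P s (+) Q s))).
  by move=> s; case: (P s); case: (Q s).
by apply/borel_negb/borel_addb.
Qed.

End BorelPredicates.

Lemma generated_preimage (Y : borelSpace) (G : set (set Y))
    (S : borelSpace) (g : S -> Y) :
  sigma_algebra setT (@borel S) -> @borel Y = <<s G >> ->
  (forall U, G U -> borel (fun s => U (g s))) -> borel_fun g.
Proof.
move=> S_sigma YG GU; rewrite /borel_fun YG; apply: smallest_sub => //.
split.
- exact: borel_cst.
- move=> A /= /(borel_notP S_sigma); apply: borel_ext => s.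
  by split=> [h|[_ h]].
- move=> F bF /=; have := borel_exists S_sigma bF.
  by apply: borel_ext => s; split=> [[n h]|[n _ h]]; exists n.
Qed.

Lemma dependent_choice_seq (T : Type) (Q : seq T -> Prop) :
  Q [::] -> (forall l, Q l -> exists p, Q (rcons l p)) ->
  exists u : nat -> T, forall n, Q (mkseq u n).
Proof.
move=> Q0 Qr.
have [t0] : exists t0 : T, True by have [p _] := Qr _ Q0; exists p.
move=> _.
have /choice[nx nxP] : forall l, exists p, Q l -> Q (rcons l p).
  move=> l; have [/Qr[p Qp]|nQ] := pselect (Q l); first by exists p.
  by exists t0 => /nQ.
pose L := fix L n := if n is n'.+1 then rcons (L n') (nx (L n')) else [::].
have LE n : mkseq (fun i => nx (L i)) n = L n.
  by elim: n => [|n IH]//; rewrite mkseqS IH.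
exists (fun i => nx (L i)) => n; rewrite LE.
by elim: n => //= n; exact: nxP.
Qed.

(** * Souslin schemes of closed sets *)

Section Souslin.
Variable Z : topologicalType.

(** The result of the Souslin operation on a scheme of closed sets indexed by finite sequences. *)
Definition souslin (A : set Z) := exists2 F : seq nat -> set Z,
  (forall s, closed (F s)) &
  forall z, A z <-> exists a : nat -> nat, forall n, F (mkseq a n) z.

Lemma souslin_closed (A : set Z) : closed A -> souslin A.
Proof.
move=> cA; exists (fun _ => A) => // z; split=> [Az|[a /(_ 0)]//].
by exists (fun _ => 0).
Qed.

Lemma mkseqSl (T : Type) (f : nat -> T) n :
  mkseq f n.+1 = f 0 :: mkseq (fun i => f i.+1) n.
Proof. by rewrite /mkseq /= -(addn0 1) iotaDl -map_comp. Qed.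

(** The first entry of a branch selects the index [k]; the remaining entries are a branch for
    [A k]. *)
Lemma souslin_bigcup (A : nat -> set Z) :
  (forall k, souslin (A k)) -> souslin (\bigcup_k A k).
Proof.
move=> sA; have /choice[F FP] : forall k, exists F : seq nat -> set Z,
    (forall s, closed (F s)) /\
    forall z, A k z <-> exists a : nat -> nat, forall n, F (mkseq a n) z.
  by move=> k; have [F] := sA k; exists F.
have cF k s : closed (F k s) by have [] := FP k.
have AE k z : A k z <-> exists a : nat -> nat, forall n, F k (mkseq a n) z.
  by have [] := FP k.
pose G s := if s is k :: s' then F k s' else setT.
exists G; first by case=> [|k s]; [exact: closedT|exact: cF].
move=> z; split=> [[k _ /AE[a Fa]]|[a Fa]].
  exists (fun n => if n is n'.+1 then a n' else k) => -[|n] //.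
  by rewrite mkseqSl.
exists (a 0) => //; apply/AE; exists (fun i => a i.+1) => n.
by have := Fa n.+1; rewrite mkseqSl.
Qed.

(** A single branch codes one branch per index [k] as its column [col a k]. The set attached to a
    finite sequence [s] imposes just those conditions whose entries [s] already determines. *)
Lemma souslin_bigcap (A : nat -> set Z) :
  (forall k, souslin (A k)) -> souslin (\bigcap_k A k).
Proof.
move=> sA; have /choice[F FP] : forall k, exists F : seq nat -> set Z,
    (forall s, closed (F s)) /\
    forall z, A k z <-> exists a : nat -> nat, forall n, F (mkseq a n) z.
  by move=> k; have [F] := sA k; exists F.
have cF k s : closed (F k s) by have [] := FP k.
have AE k z : A k z <-> exists a : nat -> nat, forall n, F k (mkseq a n) z.
  by have [] := FP k.
pose col (a : nat -> nat) (k i : nat) := a (pickle (k, i)).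
exists (fun s => \bigcap_(km in [set km : nat * nat |
    forall i, i < km.2 -> pickle (km.1, i) < size s])
  F km.1 (mkseq (col (nth 0 s) km.1) km.2)).
  by move=> s; apply: closed_bigI => km _; exact: cF.
have colE a n k m : (forall i, i < m -> pickle (k, i) < size (mkseq a n)) ->
    mkseq (col (nth 0 (mkseq a n)) k) m = mkseq (col a k) m.
  move=> h; apply/eq_in_map => i; rewrite mem_iota /= add0n => im.
  by rewrite /col nth_mkseq//; have := h _ im; rewrite size_mkseq.
move=> z; split=> [Az|[a Fa] k _].
  have /choice[a aP] : forall k, exists a : nat -> nat, forall n, F k (mkseq a n) z.
    by move=> k; apply/AE; exact: Az.
  exists (fun n => if unpickle n is Some ki then a ki.1 ki.2 else 0) => n [k m] /= h.
  rewrite colE//; move: (aP k m); congr (F k _ z); apply: eq_mkseq => i.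
  by rewrite /col pickleK.
apply/AE; exists (col a k) => m.
(* The sum exceeds every [pickle (k, i)] with [i < m], so a prefix of this length determines the
   first [m] entries of column [k]. *)
have := Fa (\sum_(i < m) (pickle (k, nat_of_ord i)).+1) (k, m).
have h i : i < m -> pickle (k, i) < \sum_(i < m) (pickle (k, nat_of_ord i)).+1.
  by move=> im; rewrite (bigD1 (Ordinal im)) //= leq_addr.
rewrite /= colE => [|i im]; last by rewrite size_mkseq h.
by apply => i im; rewrite size_mkseq h.
Qed.

(** The sets that are Souslin together with their complements form a sigma-algebra. *)
Lemma souslin_generated (G : set (set Z)) :
  (forall U, G U -> souslin U /\ souslin (~` U)) ->
  <<s G >> `<=` souslin.
Proof.
move=> GS A GA; suff : [set A | souslin A /\ souslin (~` A)] A by case.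
move: A GA; apply: smallest_sub => //; split.
- by split; [exact/souslin_closed/closed0|rewrite setC0; exact/souslin_closed/closedT].
- by move=> B [sB sCB]; rewrite setTD; split; rewrite ?setCK.
- move=> F h; split; first by apply: souslin_bigcup => k; have [] := h k.
  by rewrite setC_bigcup; apply: souslin_bigcap => k; have [] := h k.
Qed.

(* The cells of a sieve play the role of balls of radius [1/(n+1)] in a complete
   separable metric space; unlike metrics they pass to products at no cost. *)
Definition sieve (K : nat -> nat -> set Z) :=
  (forall n z, exists m, K n m z) /\
  forall c : nat -> nat, (forall N, exists z, forall n, n < N -> K n (c n) z) ->
  exists z : Z, forall U, nbhs z U ->
    exists N, forall w, (forall n, n < N -> K n (c n) w) -> U w.

End Souslin.

Lemma nat_pairing : exists p : nat -> nat * nat, forall q, exists n, p n = q.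
Proof.
exists (fun n => odflt (0, 0) (unpickle n)) => q.
by exists (pickle q); rewrite pickleK.
Qed.

Lemma sieve_prod (Y Z : topologicalType) :
  (exists K, @sieve Y K) -> (exists K, @sieve Z K) -> exists K, @sieve (Y * Z)%type K.
Proof.
move=> [K [Kc Kl]] [L [Lc Ll]]; have [p pP] := nat_pairing.
exists (fun n m => K n (p m).1 `*` L n (p m).2); split=> [n [y z]|c h].
  have [i Ky] := Kc n y; have [j Lz] := Lc n z; have [m pm] := pP (i, j).
  by exists m; rewrite pm.
have [y yP] : exists y : Y, forall U, nbhs y U -> exists N, forall w,
    (forall n, n < N -> K n (p (c n)).1 w) -> U w.
  by apply: Kl => N; have [[y z] h'] := h N; exists y => n /h'[].
have [z zP] : exists z : Z, forall U, nbhs z U -> exists N, forall w,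
    (forall n, n < N -> L n (p (c n)).2 w) -> U w.
  by apply: Ll => N; have [[y' z] h'] := h N; exists z => n /h'[].
exists (y, z) => U [[B C] /= [/yP[N hN] /zP[M hM]] BC].
exists (maxn N M) => w hw; apply: BC; split => /=.
- by apply: hN => n nN; have [] := hw n; rewrite // leq_max nN.
- by apply: hM => n nM; have [] := hw n; rewrite // leq_max nM orbT.
Qed.

Definition topo_borel (T : topologicalType) : borelSpace :=
  @BorelSpace T <<s @open T >>.

Lemma topo_borel_sigma (T : topologicalType) :
  sigma_algebra setT (@borel (topo_borel T)).
Proof. exact: smallest_sigma_algebra. Qed.

Lemma open_borel (T : topologicalType) (U : set T) :
  open U -> @borel (topo_borel T) U.
Proof. by move=> oU; apply: sub_sigma_algebra. Qed.

(** * Lusin separation of images of Souslin sets *)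

Section Separation.
Variable T : topologicalType.
Let X := topo_borel T.
Let X_sigma := topo_borel_sigma T.

Definition borel_separated (A B : set X) :=
  exists2 C : set X, borel C & A `<=` C /\ B `<=` ~` C.

(** If [C (i, j)] separates [A i] from [B j], then the union over [i] of the intersections over [j]
    separates the unions. Contrapositively, a failure of separation descends to some pair of
    pieces. *)
Lemma borel_separated_bigcup (I : countType) (A B : I -> set X) :
  (forall i j, borel_separated (A i) (B j)) ->
  borel_separated (\bigcup_i A i) (\bigcup_j B j).
Proof.
move=> h; have /choice[C CP] : forall ij, exists C : set X,
    borel C /\ A ij.1 `<=` C /\ B ij.2 `<=` ~` C.
  by move=> [i j]; have [C] := h i j; exists C.
exists (fun x => exists i, forall j, C (i, j) x).
  apply: borel_exists => // i; apply: borel_forall => // j.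
  by have [] := CP (i, j).
split=> [x [i _ Ax]|x [j _ Bx] [i /(_ j)]].
  by exists i => j; have [_ [h1 _]] := CP (i, j); exact: h1.
by have [_ [_ h2]] := CP (i, j); exact: h2.
Qed.


(** A list [l] refines in two ways at once: its first components prescribe the start of a witnessing
    branch, its second components locate the point in the sieve. *)
Definition souslin_cell (Z : topologicalType) (K : nat -> nat -> set Z)
    (F : seq nat -> set Z) (l : seq (nat * nat)) : set Z :=
  [set z | (exists a : nat -> nat, (forall n, F (mkseq a n) z) /\
              forall i, i < size l -> a i = (nth (0, 0) l i).1) /\
           forall i, i < size l -> K i (nth (0, 0) l i).2 z].

Lemma souslin_cell_nil (Z : topologicalType) K (F : seq nat -> set Z) (A : set Z) :
  (forall z, A z <-> exists a : nat -> nat, forall n, F (mkseq a n) z) ->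
  souslin_cell K F [::] = A.
Proof.
move=> AE; apply/seteqP; split=> z; first by move=> [[a [Fa _]] _]; apply/AE; exists a.
by move=> /AE[a Fa]; split=> //; exists a.
Qed.

Lemma souslin_cell_rcons (Z : topologicalType) K (F : seq nat -> set Z) l :
  sieve K -> souslin_cell K F l `<=` \bigcup_p souslin_cell K F (rcons l p).
Proof.
move=> [Kc _] z [[a [Fa al]] Kl]; have [m Km] := Kc (size l) z.
exists (a (size l), m) => //; split=> [|i]; rewrite size_rcons.
  exists a; split=> // i; rewrite ltnS leq_eqVlt nth_rcons.
  by case/orP => [/eqP ->|il]; rewrite ?ltnn ?eqxx// il al.
rewrite ltnS leq_eqVlt nth_rcons.
by case/orP => [/eqP ->|il]; rewrite ?ltnn ?eqxx// il; exact: Kl.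
Qed.

(** The sieve provides a point [z] to which the nonempty cells shrink. Every neighbourhood of [z]
    meets each [F] set along the branch, and these sets are closed. *)
Lemma souslin_cell_limit (Z : topologicalType) K (F : seq nat -> set Z)
    (u : nat -> nat * nat) :
  sieve K -> (forall s, closed (F s)) ->
  (forall n, souslin_cell K F (mkseq u n) !=set0) ->
  exists2 z, (forall n, F (mkseq (fun i => (u i).1) n) z) &
    forall U, nbhs z U -> exists N, forall n, N <= n ->
      souslin_cell K F (mkseq u n) `<=` U.
Proof.
move=> [_ Kl] cF ne.
have cellK n z : souslin_cell K F (mkseq u n) z -> forall i, i < n -> K i (u i).2 z.
  by move=> [_ h] i ni; have := h i; rewrite size_mkseq nth_mkseq//; exact.
have cellF n z : souslin_cell K F (mkseq u n) z -> forall i, i <= n ->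
    F (mkseq (fun i => (u i).1) i) z.
  move=> [[a [Fa al]] _] i ni; rewrite (_ : mkseq _ _ = mkseq a i)//.
  apply/eq_in_map => j; rewrite mem_iota add0n /= => ji.
  have jn := leq_trans ji ni.
  by rewrite al ?size_mkseq// nth_mkseq.
have [z zP] : exists z : Z, forall U, nbhs z U -> exists N, forall w,
    (forall n, n < N -> K n (u n).2 w) -> U w.
  by apply: Kl => N; have [z /cellK h] := ne N; exists z.
have zU U : nbhs z U -> exists N, forall n, N <= n ->
    souslin_cell K F (mkseq u n) `<=` U.
  move=> /zP[N NU]; exists N => n Nn w /cellK h; apply: NU => i iN.
  by apply: h; exact: leq_trans iN Nn.
exists z => // n; apply: (cF) => U /zU[N NU].
have [w cw] := ne (maxn N n); exists w; split.
  by apply: cellF cw _ _; rewrite leq_maxr.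
by apply: NU cw; rewrite leq_maxl.
Qed.

(** If separation failed, inseparable pairs of cells could be refined forever, shrinking to points
    [y] of [A] and [z] of [B]. By disjointness [f y] differs from [g z], and disjoint open
    neighbourhoods of these separate the images of late cells. *)
Lemma lusin_separation (Y Z : topologicalType)
    (f : Y -> T) (g : Z -> T) (A : set Y) (B : set Z) :
  (exists K, @sieve Y K) -> (exists K, @sieve Z K) ->
  hausdorff_space T -> continuous f -> continuous g ->
  souslin A -> souslin B -> (f @` A) `&` (g @` B) = set0 ->
  borel_separated (f @` A) (g @` B).
Proof.
move=> [K sK] [L sL] hT cf cg [F cF AE] [G cG BE] dis.
apply: contrapT => nsep.
pose Q l := ~ borel_separated (f @` souslin_cell K F (map fst l))
  (g @` souslin_cell L G (map snd l)).
have [||u uQ] := @dependent_choice_seq ((nat * nat) * (nat * nat)) Q.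
- by rewrite /Q /= (souslin_cell_nil _ AE) (souslin_cell_nil _ BE).
- move=> l; apply: contra_notP => /forallNP h.
  have := @borel_separated_bigcup (nat * nat)%type
    (fun p => f @` souslin_cell K F (rcons (map fst l) p))
    (fun p => g @` souslin_cell L G (rcons (map snd l) p)).
  case=> [p q|C bC [h1 h2]].
    by have /contrapT := h (p, q); rewrite !map_rcons.
  exists C => //; split.
  + move=> _ [y /(souslin_cell_rcons sK)[p _ yp] <-]; apply: h1.
    by exists p => //; exists y.
  + move=> _ [y /(souslin_cell_rcons sL)[p _ yp] <-]; apply: h2.
    by exists p => //; exists y.
have E1 n : map fst (mkseq u n) = mkseq (fun i => (u i).1) n by rewrite -map_comp.
have E2 n : map snd (mkseq u n) = mkseq (fun i => (u i).2) n by rewrite -map_comp.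
(* An empty cell would be separated trivially, so all cells along [u] are nonempty. *)
have [n|y Fy yU] := @souslin_cell_limit _ K F (fun i => (u i).1) sK cF.
  apply: contrapT => /set0P/negP/negPn/eqP e; apply: (uQ n).
  rewrite E1 e image_set0; exists set0; first by case: X_sigma.
  by split=> //; rewrite setC0.
have [n|z Gz zU] := @souslin_cell_limit _ L G (fun i => (u i).2) sL cG.
  apply: contrapT => /set0P/negP/negPn/eqP e; apply: (uQ n).
  rewrite E2 e image_set0; exists setT; first exact: borel_cst.
  by split.
have Ay : A y by apply/AE; exists (fun i => (u i).1.1).
have Bz : B z by apply/BE; exists (fun i => (u i).2.1).
have yz : f y != g z.
  apply/eqP => e; suff : ((f @` A) `&` (g @` B)) (f y) by rewrite dis.
  by split; [exists y|rewrite e; exists z].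
move: hT; rewrite open_hausdorff => /(_ _ _ yz)[[U V] /= [yUin zVin] [oU oV /eqP UV]].
rewrite !inE in yUin zVin.
have [N1 h1] := yU (f @^-1` U) (cf y U (open_nbhs_nbhs (conj oU yUin))).
have [N2 h2] := zU (g @^-1` V) (cg z V (open_nbhs_nbhs (conj oV zVin))).
apply: (uQ (maxn N1 N2)); rewrite E1 E2.
exists U; first exact: open_borel.
split; first by move=> _ [w /(h1 _ (leq_maxl _ _)) h <-].
move=> _ [w /(h2 _ (leq_maxr _ _)) h <-] h'.
by suff : (U `&` V) (g w) by rewrite UV.
Qed.

End Separation.

Lemma souslin_preimage (Y Z : topologicalType) (f : Y -> Z) (A : set Z) :
  continuous f -> souslin A -> souslin (f @^-1` A).
Proof.
move=> cf [F cF AE]; exists (fun s => f @^-1` F s) => [s|y]; last exact: AE.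
by apply: closed_comp => // y _; exact: cf.
Qed.

(** * Uniformization over Polish spaces *)

Section Polish.
Variables (R : realType) (P : metricType R).
Hypotheses (P_separable : separable_space P) (P_complete : complete_space P).
Let bP := topo_borel P.
Let bP_sigma := topo_borel_sigma P.

Local Open Scope ring_scope.

Definition radius n : R := n.+1%:R^-1.

Lemma radius_gt0 n : 0 < radius n.
Proof. by rewrite invr_gt0. Qed.

Lemma radius_lt (e : R) : 0 < e -> exists N, forall n, (N <= n)%N -> radius n < e.
Proof.
move=> e0; have [N _ h] := near_infty_natSinv_lt (PosNum e0).
by exists N => n Nn; exact: h.
Qed.

Lemma divr2_gt0 (e : R) : 0 < e -> 0 < e / 2.
Proof. by move=> e0; rewrite divr_gt0. Qed.

Lemma open_mdist (x : P) (e : R) : open [set y | mdist x y < e].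
Proof.
rewrite openE => y /= xye; apply/nbhs_ballP.
exists (e - mdist x y) => /=; first by rewrite subr_gt0.
move=> z; rewrite ballEmdist /= => yz.
by have := metric_triangle x y z; lra.
Qed.

Lemma open_mdistP (U : set P) x : open U -> U x ->
  exists2 e : R, 0 < e & forall y, mdist x y < e -> U y.
Proof.
rewrite openE => oU /oU /nbhs_ballP[e e0 eU]; exists e => // y xy.
by apply: eU; rewrite ballEmdist.
Qed.

Lemma dense_sequence : P ->
  exists d : nat -> P, forall (x : P) (e : R), 0 < e -> exists m, mdist (d m) x < e.
Proof.
move=> x0; have [D cD dD] := P_separable.
have [f finj] := countable_injP _ cD.
exists (fun m => xget x0 [set x | D x /\ f x = m]) => x e e0.
have [|y [/= xy Dy]] := dD _ _ (open_mdist x e).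
  by exists x; rewrite /= mdistxx.
exists (f y); case: xgetP => [z _ [Dz /finj zy]|/(_ y)[]//].
by rewrite zy ?inE// metric_sym.
Qed.

Definition cell (d : nat -> P) n m : set P := [set z | mdist (d m) z < radius n].

Lemma filter_cauchyP (F : set_system P) : ProperFilter F ->
  (forall e : R, 0 < e -> exists2 A, F A & forall x y, A x -> A y -> mdist x y < e) ->
  exists x : P, F --> x.
Proof.
move=> FF h; apply: P_complete => //; apply/cauchyP => e e0.
have [A FA Ae] := h e e0; have [x Ax] := filter_ex FA.
exists x; apply: filterS FA => y Ay; rewrite ballEmdist; exact: Ae.
Qed.

(** The cells are balls around a dense sequence. The finite intersections of the chosen balls
    generate a Cauchy filter, which converges by completeness. *)
Lemma sieve_polish : exists K, @sieve P K.
Proof.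
have [x0|P0] := pselect (exists x : P, True); last first.
  by exists (fun _ _ => set0); split=> [n z|c /(_ 0%N)[z _]]; exfalso; apply: P0;
    exists z.
case: x0 => x0 _; have [d dP] := dense_sequence x0.
exists (cell d); split=> [n z|c ne].
  by have [m] := dP z (radius n) (radius_gt0 n); exists m.
pose C N := [set z | forall n, (n < N)%N -> cell d n (c n) z].
pose F := filter_from [set: nat] C.
have FF : ProperFilter F.
  apply: filter_from_proper => [|N _]; last by have [z h] := ne N; exists z.
  apply: filter_from_filter => [|N M _ _]; first by exists 0%N.
  exists (maxn N M) => // z h; split=> n nN; apply: h.
    by rewrite leq_max nN.
  by rewrite leq_max nN orbT.
have [z Fz] : exists z : P, F --> z.
  apply: filter_cauchyP => e e0.
  have [n /(_ n (leqnn n)) ne2] := radius_lt (divr2_gt0 e0).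
  exists (C n.+1); first by exists n.+1.
  move=> x y /(_ n (ltnSn n)); rewrite /cell/= => h1 /(_ n (ltnSn n)) h2.
  have := metric_triangle x (d (c n)) y; rewrite (metric_sym x (d _)).
  by move: ne2 h1 h2; rewrite /cell/=; lra.
by exists z => U /Fz[N _ NU]; exists N => w h; exact: NU.
Qed.

(** An open set is the union over [n] of the closed sets of points at distance at least [radius n]
    from every point of the complement. *)
Lemma souslin_open (U : set P) : open U -> souslin U.
Proof.
move=> oU; rewrite (_ : U = \bigcup_n \bigcap_(y in ~` U) ~` [set x | mdist y x < radius n]).
  apply: souslin_bigcup => n; apply: souslin_closed; apply: closed_bigI => y _.
  by apply: open_closedC; exact: open_mdist.
apply/seteqP; split=> [x /(open_mdistP oU)[e /radius_lt[n /(_ n (leqnn n)) ne] eU]|x [n _ h]].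
  exists n => // y nUy /= yx; apply: nUy; apply: eU; rewrite metric_sym.
  exact: lt_trans yx ne.
by apply: contrapT => nU; apply: (h x nU); rewrite /= mdistxx radius_gt0.
Qed.

Let Z := (P * (P * P))%type.

(** The third coordinate carries a witness, so that uniformization also covers relations between the
    first two coordinates obtained by projection. *)
Definition triple_borel : borelSpace := @BorelSpace Z
  <<s [set A | exists2 U : set P, open U &
        [\/ A = (fun z => U z.1), A = (fun z => U z.2.1) | A = (fun z => U z.2.2)]] >>.

Lemma triple_borel_sigma : sigma_algebra setT (@borel triple_borel).
Proof. exact: smallest_sigma_algebra. Qed.

Lemma borel_triple1 : @borel_fun triple_borel bP (fun z => z.1).
Proof.
apply: (@generated_preimage bP (@open P)) => //; first exact: triple_borel_sigma.
by move=> U oU; apply: sub_sigma_algebra; exists U => //; constructor 1.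
Qed.

Lemma borel_triple2 : @borel_fun triple_borel bP (fun z => z.2.1).
Proof.
apply: (@generated_preimage bP (@open P)) => //; first exact: triple_borel_sigma.
by move=> U oU; apply: sub_sigma_algebra; exists U => //; constructor 2.
Qed.

Lemma borel_triple3 : @borel_fun triple_borel bP (fun z => z.2.2).
Proof.
apply: (@generated_preimage bP (@open P)) => //; first exact: triple_borel_sigma.
by move=> U oU; apply: sub_sigma_algebra; exists U => //; constructor 3.
Qed.

Lemma triple_borel_souslin (A : set Z) : @borel triple_borel A -> souslin A.
Proof.
apply: souslin_generated => B [U oU].
have sU (f : Z -> P) : continuous f -> souslin (f @^-1` U) /\ souslin (~` (f @^-1` U)).
  move=> cf; split; first by apply: souslin_preimage => //; exact: souslin_open.
  apply: souslin_closed; apply: open_closedC.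
  by apply: open_comp => // y _; exact: cf.
case=> ->; apply: sU => z.
- exact: cvg_fst.
- by apply: (cvg_comp (snd : Z -> P * P) fst); [exact: cvg_snd|exact: cvg_fst].
- by apply: (cvg_comp (snd : Z -> P * P) snd); [exact: cvg_snd|exact: cvg_snd].
Qed.

(* The Lusin-Novikov theorem for sections with at most one point.  As [h] is total,
   its graph may be larger than the relation. *)
Lemma borel_uniformization (Q : triple_borel -> Prop) : borel Q ->
  (forall x y z y' z', Q (x, (y, z)) -> Q (x, (y', z')) -> y = y') ->
  exists2 h : bP -> bP, borel_fun h & forall x y z, Q (x, (y, z)) -> y = h x.
Proof.
move=> bQ Qfun.
have [x0|P0] := pselect (exists x : P, True); last first.
  by exists id => // x; exfalso; apply: P0; exists x.
case: x0 => x0 _; have [d dP] := dense_sequence x0.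
(* [B (n, m)] is a Borel test on [x] alone for the value [y] lying in a cell: as [y] is determined
   by [x], the projections of the two halves of [Q] are disjoint and Lusin separation applies. *)
have /choice[B BP] : forall nm : nat * nat, exists B : set P,
    [/\ @borel bP B,
      forall x y z, Q (x, (y, z)) -> cell d nm.1 nm.2 y -> B x &
      forall x y z, Q (x, (y, z)) -> ~ cell d nm.1 nm.2 y -> ~ B x].
  move=> [n m]; pose A (b : bool) : set Z :=
    [set w | Q w /\ (if b then cell d n m w.2.1 else ~ cell d n m w.2.1)].
  have sA b : souslin (A b).
    apply: triple_borel_souslin; apply: borel_and => //.
      exact: triple_borel_sigma.
    have bc : @borel triple_borel (fun w => cell d n m w.2.1).
      by apply: (borel_triple2 (B := cell d n m)); apply: open_borel; exact: open_mdist.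
    by case: b; [exact: bc|exact: (borel_notP triple_borel_sigma bc)].
  have sZ : exists K, @sieve Z K.
    by apply: sieve_prod; [|apply: sieve_prod]; exact: sieve_polish.
  have cf : continuous (fst : Z -> P) by move=> z; exact: cvg_fst.
  have [|C bC [h1 h2]] :=
      lusin_separation sZ sZ (@metric_hausdorff _ P) cf cf (sA true) (sA false).
    rewrite -subset0 => x [[[x1 [y z]] [/= q k] /= <-]] [[x2 [y' z']] [/= q' k'] /= e].
    by rewrite e in q'; apply: k'; rewrite -(Qfun _ _ _ _ _ q q').
  exists C; split=> // x y z q k; first by apply: h1; exists (x, (y, z)).
  by apply: h2; exists (x, (y, z)).
have bB nm : @borel bP (B nm) by have [] := BP nm.
have BE n m x y z : Q (x, (y, z)) -> B (n, m) x <-> cell d n m y.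
  have [_ h1 h2] := BP (n, m) => q; split=> [Bx|]; last exact: h1 q.
  by apply: contrapT => /(h2 _ _ _ q).
(* The Borel set of points where the tests describe a Cauchy sequence. It contains the projection of
   [Q]. *)
pose C x := (forall n, exists m, B (n, m) x) /\
  (forall nm nm' : nat * nat, B nm x -> B nm' x ->
     mdist (d nm.2) (d nm'.2) < radius nm.1 + radius nm'.1).
have bC : @borel bP C.
  apply: borel_and => //.
    by apply: borel_forall => // n; exact: borel_exists.
  apply: borel_forall => // nm; apply: borel_forall => // nm'.
  by do 2!apply: borel_imply => //; exact: borel_cst.
have lim x : C x -> exists y, forall n m, B (n, m) x -> mdist (d m) y <= radius n.
  move=> [/choice[c cP] Cx].
  have [y cy] : exists y : P, (d \o c) n @[n --> \oo] --> y.
    apply: filter_cauchyP => e e0.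
    have [n nP] := radius_lt (divr2_gt0 e0).
    exists [set z | exists2 i, (n <= i)%N & z = d (c i)].
      by exists n => // i /= ni; exists i.
    move=> _ _ [i ni ->] [j nj ->].
    have := Cx (i, c i) (j, c j) (cP i) (cP j) => /=; have := nP i ni; have := nP j nj.
    by lra.
  exists y => n m Bnm; apply/ler_addgt0Pr => e e0.
  have [i iP] := radius_lt (divr2_gt0 e0).
  have [j _ jP] := cy _ (nbhsx_ballx y _ (divr2_gt0 e0)).
  have := jP (maxn i j) (leq_maxr _ _); rewrite /= ballEmdist /= metric_sym => h.
  have := iP (maxn i j) (leq_maxl _ _).
  have := Cx (n, m) (_, c (maxn i j)) Bnm (cP (maxn i j)) => /=.
  have := metric_triangle (d m) (d (c (maxn i j))) y.
  by lra.
(* Off [C] the function is the identity, which keeps it Borel. *)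
have /choice[h hP] : forall x, exists y,
    (C x -> forall n m, B (n, m) x -> mdist (d m) y <= radius n) /\ (~ C x -> y = x).
  move=> x; have [/[dup] Cx /lim[y yP]|nC] := pselect (C x); first by exists y.
  by exists x.
exists h.
  apply: (@generated_preimage bP (@open P)) => // U oU.
  (* On [C], the value [h x] lies in [U] iff some closed ball contained in [U] passes its test at
     [x]. *)
  pose W n m := forall y, mdist (d m) y <= radius n -> U y.
  apply: (@borel_ext bP (fun x =>
    (C x /\ exists nm, B nm x /\ W nm.1 nm.2) \/ (~ C x /\ U x))).
    move=> x; have [h1 h2] := hP x.
    have [Cx|nC] := pselect (C x); last first.
      by rewrite (h2 nC); split=> [[[]//|[]]|]; last right.
    split=> [[[_ [[n m] [/= Bx WU]]]|[]//]|].
      by apply: WU; exact: h1.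
    move=> /(open_mdistP oU)[e e0 eU]; left; split=> //.
    have [n /(_ n (leqnn n)) ne] := radius_lt (divr2_gt0 e0).
    have [m Bx] := Cx.1 n; exists (n, m); split=> // y dy; apply: eU.
    have := metric_triangle (h x) (d m) y; rewrite (metric_sym (h x) (d m)).
    by move: ne (h1 Cx n m Bx) dy => /=; lra.
  apply: borel_or => //; apply: borel_and => //.
  - by apply: borel_exists => // nm; apply: borel_and => //; exact: borel_cst.
  - exact: borel_notP.
  - exact: open_borel.
move=> x y z q.
have Cx : C x.
  split=> [n|[n m] [n' m'] /(BE n m _ _ _ q) k /(BE n' m' _ _ _ q) k'].
    have [m] := dP y (radius n) (radius_gt0 n); exists m; exact/(BE n m _ _ _ q).
  have := metric_triangle (d m) y (d m'); rewrite (metric_sym y).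
  by move: k k'; rewrite /cell /=; lra.
apply: mdist_positivity; apply/eqP; rewrite eq_le mdist_ge0 andbT.
apply/ler_addgt0Pr => e e0; rewrite add0r.
have [n /(_ n (leqnn n)) ne] := radius_lt (divr2_gt0 e0).
have [m Bx] := Cx.1 n.
have k := (BE n m _ _ _ q).1 Bx; have := (hP x).1 Cx n m Bx.
have := metric_triangle y (d m) (h x); rewrite (metric_sym y (d m)).
by move: k ne; rewrite /cell /=; lra.
Qed.

End Polish.

(** * Borel enumeration of neighbours *)

Section Enumeration.
Variables (R : realType) (P : metricType R).
Hypotheses (P_separable : separable_space P) (P_complete : complete_space P).
Let bP := topo_borel P.

(** Stated by substituting Borel maps from an arbitrary space, so that relations compose without
    reference to a product space. *)
Definition borel_rel (r : P -> P -> Prop) := forall S : borelSpace,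
  sigma_algebra setT (@borel S) -> forall g h : S -> bP,
  borel_fun g -> borel_fun h -> @borel S (fun s => r (g s) (h s)).

Lemma separating_sequence : exists2 U : nat -> set P,
  forall j, open (U j) & forall x y, (forall j, U j x <-> U j y) -> x = y.
Proof.
have [x0|P0] := pselect (exists x : P, True); last first.
  exists (fun _ => set0) => [_|x]; first exact: open0.
  by exfalso; apply: P0; exists x.
case: x0 => x0 _; have [d dP] := dense_sequence P_separable x0.
have [p pP] := nat_pairing.
exists (fun j => cell d (p j).1 (p j).2) => [j|x y xy]; first exact: open_mdist.
apply/eqP; apply: contrapT => /negP; rewrite -mdist_gt0 => xy0.
have [n /(_ n (leqnn n)) ne] := radius_lt (divr2_gt0 xy0).
have [m dx] := dP x _ (radius_gt0 R n).
have [j pj] := pP (n, m); have := xy j; rewrite pj /cell /= => -[/(_ dx) dy _].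
have := metric_triangle x (d m) y; rewrite (metric_sym x (d m)).
by lra.
Qed.

(** Points are compared lexicographically by their membership in a separating sequence of open
    sets. *)
Lemma borel_tournament : exists lt : rel P,
  [/\ irreflexive lt, forall x y, x != y -> lt x y = ~~ lt y x & borel_rel lt].
Proof.
have [U oU UI] := separating_sequence.
pose D x y j := (forall i, i < j -> (U i x <-> U i y)) /\ ~ U j x /\ U j y.
exists (fun x y => `[< exists j, D x y j >]); split.
- by move=> x; apply/asboolPn => -[j [_ []]].
- move=> x y xy.
  have ex : exists j, `[< ~ (U j x <-> U j y) >].
    have /existsNP[j Hj] : ~ forall j, U j x <-> U j y.
      by move=> /UI /eqP; rewrite (negbTE xy).
    by exists j; apply/asboolP.
  case: (ex_minnP ex) => j /asboolP Uj jmin.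
  have least i : i < j -> (U i x <-> U i y).
    move=> ij; apply: contrapT => /asboolP /jmin; by rewrite leqNgt ij.
  have uniq_j i u v : (u = x /\ v = y) \/ (u = y /\ v = x) -> D u v i -> i = j.
    move=> uv [h [h1 h2]]; case: (ltngtP i j) => // [/least e|/h e].
      by case: uv => -[eu ev]; subst; tauto.
    by case: uv => -[eu ev]; subst; tauto.
  apply/asboolP/asboolPn => [[i Dxy] [k Dyx]|nD].
    have ij := uniq_j _ _ _ (or_introl (conj erefl erefl)) Dxy.
    have kj := uniq_j _ _ _ (or_intror (conj erefl erefl)) Dyx.
    by subst; case: Dxy Dyx => [_ [h1 h2]] [_ [h3 h4]].
  have [Ux|nUx] := pselect (U j x); last first.
    by exists j; split=> //; split=> //; apply: contrapT => nUy; apply: Uj.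
  exfalso; apply: nD; exists j; split; last by split=> // Uy; apply: Uj.
  by move=> i ij; split=> /least -/(_ ij).
- move=> S S_sigma g h bg bh; apply: borel_asbool => //.
  have bU (k : S -> bP) j : borel_fun k -> @borel S (fun s => U j (k s)).
    by move=> bk; apply: (bk (U j)); exact: open_borel.
  apply: borel_exists => // j; apply: borel_and => //.
    apply: borel_forall => // i; apply: borel_imply => //; first exact: borel_cst.
    by apply: borel_iff => //; exact: bU.
  by apply: borel_and => //; [apply: borel_notP => //|]; exact: bU.
Qed.

Variable lt : rel P.
Hypothesis lt_irr : irreflexive lt.
Hypothesis lt_tournament : forall x y, x != y -> lt x y = ~~ lt y x.
Hypothesis lt_borel : borel_rel lt.

Lemma borel_rel_eq : borel_rel (fun x y => x == y).
Proof.
move=> S S_sigma g h bg bh.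
apply: (@borel_ext S (fun s => ~~ lt (g s) (h s) && ~~ lt (h s) (g s))).
  move=> s; have [->|/lt_tournament] := eqVneq (g s) (h s); first by rewrite lt_irr.
  by case: lt => // /esym; case: lt.
by apply: borel_andb => //; apply: borel_negb => //; exact: lt_borel.
Qed.

Variables (A : rel P) (c : P -> nat).
Hypothesis A_borel : borel_rel A.
Hypothesis A_sym : symmetric A.
Hypothesis c_borel : forall i, @borel bP (fun x => c x == i).
Hypothesis c_proper : forall x y, A x y -> c x != c y.
Hypothesis claw_free : forall x y z w, A x y -> A x z -> A x w ->
  y != z -> z != w -> y != w -> [|| A y z, A z w | A y w].

Lemma borel_color (S : borelSpace) (g : S -> bP) i :
  borel_fun g -> @borel S (fun s => c (g s) == i).
Proof. by move=> bg; exact: (bg _ (c_borel i)). Qed.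

Lemma two_per_color x y z w : A x y -> A x z -> A x w ->
  c y = c z -> c z = c w -> y != z -> w = y \/ w = z.
Proof.
move=> xy xz xw yz zw nyz; have [->|nwy] := eqVneq w y; first by left.
have [->|nwz] := eqVneq w z; first by right.
have := claw_free xy xz xw nyz; rewrite ![_ == w]eq_sym => /(_ nwz nwy).
by case/or3P => /c_proper; rewrite ?yz ?zw eqxx.
Qed.

(** If [x] has two neighbours of colour [i], then [h1] and [h2] give the smaller and the larger one
    for [lt], each uniformized with the other as witness. Elsewhere there is at most one such
    neighbour, given by [h3]. *)
Lemma neighbor_functions_color i : exists g : nat -> bP -> bP,
  (forall j, borel_fun (g j)) /\
  forall x y, A x y -> c y = i -> exists j, y = g j x.
Proof.
have Z_sigma := triple_borel_sigma P.
have b1 := @borel_triple1 _ P; have b2 := @borel_triple2 _ P.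
have b3 := @borel_triple3 _ P.
have lt_asym x y : lt x y -> lt y x -> False.
  have [->|/lt_tournament ->] := eqVneq x y; first by rewrite lt_irr.
  by move/negP.
pose Q (flip : bool) (w : triple_borel P) :=
  [&& A w.1 w.2.1, A w.1 w.2.2, c w.2.1 == i, c w.2.2 == i &
      if flip then lt w.2.2 w.2.1 else lt w.2.1 w.2.2].
have bQ flip : borel (Q flip).
  apply: borel_andb => //; first exact: A_borel.
  apply: borel_andb => //; first exact: A_borel.
  apply: borel_andb => //; first exact: borel_color b2.
  apply: borel_andb => //; first exact: borel_color b3.
  by case: flip; exact: lt_borel.
have Q_fun flip x y z y' z' : Q flip (x, (y, z)) -> Q flip (x, (y', z')) -> y = y'.
  move=> /and5P[/= xy xz /eqP cy /eqP cz yz] /and5P[/= xy' xz' /eqP cy' /eqP cz' yz'].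
  apply/eqP; apply: contrapT => /negP nyy'.
  have cc : c y = c y' by rewrite cy cy'.
  have two w : A x w -> c w = i -> w = y \/ w = y'.
    by move=> xw cw; apply: (two_per_color xy xy' xw) => //; rewrite cy' cw.
  have [zy|zy] := two z xz cz; first by move: (yz); rewrite zy lt_irr if_same.
  have [zy'|zy'] := two z' xz' cz'; last by move: (yz'); rewrite zy' lt_irr if_same.
  rewrite zy in yz; rewrite zy' in yz'.
  by case: (flip) yz yz' => h1 h2; exact: (lt_asym _ _ h1 h2).
have [h1 bh1 h1P] := borel_uniformization P_separable P_complete (bQ false) (@Q_fun false).
have [h2 bh2 h2P] := borel_uniformization P_separable P_complete (bQ true) (@Q_fun true).
(* [h1] and [h2] are total, so [D] tests whether their values really are two neighbours of colour
   [i]. *)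
pose D x := [&& A x (h1 x), A x (h2 x), c (h1 x) == i, c (h2 x) == i & h1 x != h2 x].
have bD (S : borelSpace) (g : S -> bP) : sigma_algebra setT (@borel S) ->
    borel_fun g -> @borel S (fun s => D (g s)).
  move=> S_sigma bg.
  have c1 : borel_fun (fun s => h1 (g s)) by move=> B bB; exact: (bg _ (bh1 _ bB)).
  have c2 : borel_fun (fun s => h2 (g s)) by move=> B bB; exact: (bg _ (bh2 _ bB)).
  apply: borel_andb => //; first exact: A_borel.
  apply: borel_andb => //; first exact: A_borel.
  apply: borel_andb => //; first exact: borel_color c1.
  apply: borel_andb => //; first exact: borel_color c2.
  by apply: borel_negb => //; exact: borel_rel_eq.
pose Q3 (w : triple_borel P) := [&& A w.1 w.2.1, c w.2.1 == i & ~~ D w.1].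
have bQ3 : borel Q3.
  apply: borel_andb => //; first exact: A_borel.
  apply: borel_andb => //; first exact: borel_color b2.
  by apply: borel_negb => //; exact: bD.
have Q3_fun x y z y' z' : Q3 (x, (y, z)) -> Q3 (x, (y', z')) -> y = y'.
  move=> /and3P[/= xy /eqP cy nD] /and3P[/= xy' /eqP cy' _].
  apply/eqP; apply: contraNT nD => nyy'.
  wlog yy' : y y' xy cy xy' cy' nyy' / lt y y'.
    have [yy'|nlt] := boolP (lt y y'); first by move=> /(_ y y'); apply.
    move=> /(_ y' y); apply => //; first by rewrite eq_sym.
    by move: (lt_tournament nyy'); rewrite (negbTE nlt) => /esym/negbFE.
  have e1 : y = h1 x.
    by apply: (h1P x y y'); rewrite /Q /= xy xy' cy cy' eqxx yy'.
  have e2 : y' = h2 x.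
    by apply: (h2P x y' y); rewrite /Q /= xy xy' cy cy' eqxx yy'.
  by rewrite /D -e1 -e2 xy xy' cy cy' eqxx nyy'.
have [h3 bh3 h3P] := borel_uniformization P_separable P_complete bQ3 (@Q3_fun).
exists (fun j => if j is 0 then h1 else if j is 1 then h2 else h3).
split=> [[|[]]//|x y xy cy].
have [/and5P[x1 x2 /eqP c1 /eqP c2 n12]|nD] := boolP (D x).
  have [| |->|->] := two_per_color x1 x2 xy _ _ n12; first by rewrite c1.
  - by rewrite c2.
  - by exists 0.
  - by exists 1.
by exists 2; apply: (h3P x y y); rewrite /Q3 /= xy cy eqxx nD.
Qed.

Lemma neighbor_functions : exists f : nat -> bP -> bP,
  [/\ forall k, borel_fun (f k), f 0 = id &
      forall x y, A x y -> exists k, y = f k x].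
Proof.
have /choice[g gP] := neighbor_functions_color.
have [p pP] := nat_pairing.
exists (fun k => if k is k'.+1 then g (p k').1 (p k').2 else id); split=> //.
- by case=> [//|k]; have [h _] := gP (p k).1; exact: h.
- move=> x y xy; have [_ h] := gP (c y); have [j yj] := h x y xy erefl.
  by have [k pk] := pP (c y, j); exists k.+1; rewrite pk.
Qed.

End Enumeration.

(** * The Borel root graph *)

Section Ends.
Variables (R : realType) (P : metricType R).
Let bP := topo_borel P.
Variables (A lt : rel P) (c : P -> nat) (f : nat -> bP -> bP).
Hypothesis A_borel : borel_rel A.
Hypothesis lt_borel : borel_rel lt.
Hypothesis eq_borel : borel_rel (fun x y : P => x == y).
Hypothesis A_sym : symmetric A.
Hypothesis A_irr : irreflexive A.
Hypothesis c_borel : forall i, @borel bP (fun x => c x == i).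
Hypothesis c_proper : forall x y, A x y -> c x != c y.
Hypothesis f_borel : forall k, borel_fun (f k).
Hypothesis f0 : f 0 = id.
Hypothesis fP : forall x y, A x y -> exists k, y = f k x.

Definition borel_rel3 (t : P -> P -> P -> Prop) := forall S : borelSpace,
  sigma_algebra setT (@borel S) -> forall g h l : S -> bP,
  borel_fun g -> borel_fun h -> borel_fun l -> @borel S (fun s => t (g s) (h s) (l s)).

Lemma borel_fun_comp (X Y W : borelSpace) (g : Y -> W) (h : X -> Y) :
  borel_fun g -> borel_fun h -> borel_fun (g \o h).
Proof. by move=> bg bh B /bg /bh. Qed.

(** A witness is adjacent to an odd, hence positive, number of the three points, so it is enumerated
    by some [f k] from one of them. *)
Lemma odd_triple_borel : borel_rel3 (odd_triple A).
Proof.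
move=> S S_sigma g h l bg bh bl; apply: borel_asbool => //.
pose t s w := A w (g s) (+) A w (h s) (+) A w (l s).
have bt k (a : S -> bP) : borel_fun a -> borel (fun s => t s (f k (a s))).
  move=> ba; have bf := borel_fun_comp (@f_borel k) ba.
  by apply: borel_addb => //; [apply: borel_addb => //|]; exact: A_borel.
apply: (@borel_ext S (fun s => exists k,
    t s (f k (g s)) \/ t s (f k (h s)) \/ t s (f k (l s)))).
  move=> s; split=> [[k]|[w tw]].
    by case=> [|[]] h'; [exists (f k (g s))|exists (f k (h s))|exists (f k (l s))].
  have : [|| A w (g s), A w (h s) | A w (l s)].
    by move: tw; rewrite /t; do 3!case: (A w _).
  rewrite ![A w _]A_sym.
  by case/or3P => /fP[k wk]; exists k; rewrite -wk; tauto.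
apply: borel_exists => // k; apply: borel_or => //; first exact: bt.
by apply: borel_or => //; exact: bt.
Qed.

Lemma borel_common_neighbor_odd : borel_rel3 (fun x y _ =>
  forall w, A w x -> A w y -> ~~ odd_triple A x y w).
Proof.
move=> S S_sigma g h l bg bh _.
apply: (@borel_ext S (fun s => forall k, A (f k (g s)) (g s) -> A (f k (g s)) (h s) ->
    ~~ odd_triple A (g s) (h s) (f k (g s)))).
  move=> s; split=> [H w wg wh|H k]; last exact: H.
  have [k wk] : exists k, w = f k (g s) by apply: fP; rewrite A_sym.
  by rewrite wk in wg wh *; exact: H.
apply: borel_forall => // k; have bf := borel_fun_comp (@f_borel k) bg.
apply: borel_imply => //; first exact: A_borel.
apply: borel_imply => //; first exact: A_borel.
by apply: borel_negb => //; exact: odd_triple_borel.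
Qed.

Lemma exceptional_borel : borel_rel3 (exceptional A).
Proof.
move=> S S_sigma g h l bg bh bl.
have H (a b : S -> bP) : borel_fun a -> borel_fun b -> @borel S (fun s =>
    `[< forall w, A w (a s) -> A w (b s) -> ~~ odd_triple A (a s) (b s) w >]).
  move=> ba bb; apply: borel_asbool => //.
  exact: (borel_common_neighbor_odd S_sigma ba bb bb).
apply: borel_andb => //; first by apply: borel_negb => //; exact: odd_triple_borel.
by apply: borel_andb => //; [|apply: borel_andb => //]; exact: H.
Qed.

Lemma above_antipode_borel (S : borelSpace) (g : S -> bP) :
  sigma_algebra setT (@borel S) -> borel_fun g ->
  @borel S (fun s => above_antipode A lt (g s)).
Proof.
move=> S_sigma bg; apply: borel_asbool => //.
pose t x x' y := [&& x' != x, ~~ A x' x, A y x, A y x' & lt x' x].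
apply: (@borel_ext S (fun s => exists kl, t (g s) (f kl.2 (f kl.1 (g s))) (f kl.1 (g s)))).
  move=> s; split=> [[[k l] /= h]|[x' [y h]]].
    by exists (f l (f k (g s))), (f k (g s)).
  have /and5P[_ _ yx yx' _] := h.
  have [k yk] : exists k, y = f k (g s) by apply: fP; rewrite A_sym.
  have [l x'l] := fP yx'; exists (k, l) => /=.
  by rewrite -yk -x'l.
apply: borel_exists => // -[k l] /=.
have by_ := borel_fun_comp (@f_borel k) bg.
have bx' := borel_fun_comp (@f_borel l) by_.
apply: borel_andb => //; first by apply: borel_negb => //; exact: eq_borel.
apply: borel_andb => //; first by apply: borel_negb => //; exact: A_borel.
apply: borel_andb => //; first exact: A_borel.
by apply: borel_andb => //; [exact: A_borel|exact: lt_borel].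
Qed.

Lemma star_borel : borel_rel3 (star A lt).
Proof.
move=> S S_sigma g h l bg bh bl; apply: borel_andb => //.
  apply: borel_andb => //; first exact: A_borel.
  by apply: borel_andb => //; exact: A_borel.
apply: borel_orb => //; first exact: odd_triple_borel.
apply: borel_andb => //; first exact: exceptional_borel.
apply: borel_negb => //; apply: borel_addb => //; last exact: above_antipode_borel.
by apply: borel_addb => //; exact: above_antipode_borel.
Qed.

(** * Ends and their canonical representatives *)

Hypothesis star_trans : forall x a b d, a != d ->
  star A lt x a b -> star A lt x b d -> star A lt x a d.
Hypothesis star_two : forall x a b d, A x a -> A x b -> A x d ->
  a != b -> b != d -> a != d ->
  [|| star A lt x a b, star A lt x b d | star A lt x a d].

(* The endpoints of [x], as an edge of the root graph, are the at most two maximal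
   stars through [x]; [second_end x y] tells which of them contains [y], the first
   one being that of the first neighbour of [x]. *)
Definition second_end x y :=
  `[< forall k, A x (f k x) -> (forall j, j < k -> ~~ A x (f j x)) ->
      (y != f k x) && ~~ star A lt x y (f k x) >].

Lemma second_end_borel : borel_rel second_end.
Proof.
move=> S S_sigma g h bg bh; apply: borel_asbool => //.
apply: borel_forall => // k; have bf j := borel_fun_comp (@f_borel j) bg.
apply: borel_imply => //; first by apply: A_borel => //; exact: bf.
apply: borel_imply => //.
  apply: borel_forall => // j; apply: borel_imply => //; first exact: borel_cst.
  by apply: borel_negb => //; apply: A_borel => //; exact: bf.
apply: borel_andb => //; apply: borel_negb => //.
  by apply: eq_borel => //; exact: bf.
by apply: star_borel => //; exact: bf.
Qed.

(** Lying in a common star with [x] is transitive on neighbours by [star_trans] and has at most two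
    classes by [star_two]; comparison with the first neighbour [y0] tells the classes apart. *)
Lemma second_endE x y z : A x y -> A x z -> y != z ->
  (second_end x y == second_end x z) = star A lt x y z.
Proof.
move=> xy xz yz.
have [k0 k0P kmin] : exists2 k, A x (f k x) & forall j, j < k -> ~~ A x (f j x).
  have ex : exists k, A x (f k x) by have [k yk] := fP xy; exists k; rewrite -yk.
  case: (ex_minnP ex) => k Ak kmin; exists k => // j jk; apply/negP => /kmin.
  by rewrite leqNgt jk.
set y0 := f k0 x in k0P.
have E w : second_end x w = (w != y0) && ~~ star A lt x w y0.
  apply/asboolP/idP => [h|h k xk kk]; first exact: h.
  suff -> : k = k0 by [].
  by case: (ltngtP k k0) => // [/kmin|/kk]; rewrite ?xk // -/y0 k0P.
have sym u v w : star A lt u v w = star A lt u w v by exact: star23.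
rewrite !E; apply/eqP/idP => [|s].
  have [yE|yy0 /=] := eqVneq y y0.
    by rewrite yE in yz *; rewrite eq_sym yz /= => /esym/negbFE; rewrite sym.
  have [->/=|zy0 /=] := eqVneq z y0; first by move/negbFE.
  have [sy|nsy] := boolP (star A lt x y y0).
    by move/esym/negbFE; rewrite sym; exact: star_trans.
  move=> /esym nsz; have := star_two xy xz k0P yz zy0 yy0.
  by rewrite (negbTE nsz) (negbTE nsy) !orbF.
have [yE|yy0 /=] := eqVneq y y0.
  by rewrite -yE eq_sym yz sym s.
have [zE|zy0 /=] := eqVneq z y0; first by rewrite -zE s.
congr (~~ _); apply/idP/idP => h.
  by apply: star_trans h => //; rewrite sym.
exact: star_trans h.
Qed.

Definition same_vertex (u v : P * bool) :=
  u = v \/ [/\ A u.1 v.1, second_end u.1 v.1 = u.2 & second_end v.1 u.1 = v.2].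

Lemma same_vertex_sym u v : same_vertex u v -> same_vertex v u.
Proof. by case=> [->|[uv eu ev]]; [left|right; rewrite A_sym]. Qed.

(** When the three carriers are distinct, equal bits at [v] make them a star, and the symmetry of
    [star] yields the bits at [u] and [w]. *)
Lemma same_vertex_trans u v w : same_vertex u v -> same_vertex v w -> same_vertex u w.
Proof.
case=> [->//|[uv eu ev]] [<-|[vw ev' ew]]; first by right.
have [uw|uw] := eqVneq u.1 w.1.
  left; rewrite [u]surjective_pairing [w]surjective_pairing uw.
  by congr pair; rewrite -eu -ew uw.
have vu : A v.1 u.1 by rewrite A_sym.
have s : star A lt v.1 u.1 w.1 by rewrite -second_endE// ev ev'.
have /andP[/and3P[_ Auw _] _] := s.
have wu : A w.1 u.1 by rewrite A_sym.
have wv : A w.1 v.1 by rewrite A_sym.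
have neq x y : A x y -> x != y by apply: contraTneq => ->; rewrite A_irr.
right; split=> //.
  rewrite -eu; apply/esym/eqP; rewrite second_endE ?neq//.
  by rewrite star12.
rewrite -ew; apply/eqP; rewrite second_endE ?neq 1?A_sym//.
by rewrite star12// star23// star12//  star23.
Qed.

(* Among the ends forming one vertex of the root graph, the one carried by the
   vertex of [L] of least colour is canonical. *)
Definition leader x (i : bool) y := [/\ A x y, second_end x y = i, c y < c x &
  forall k, A x (f k x) -> second_end x (f k x) = i -> c y <= c (f k x)].

Lemma endpoint_exists : exists r : P -> bool -> P * bool, forall x i,
  (exists2 y, leader x i y & r x i = (y, second_end y x)) \/
  (forall y, ~ leader x i y) /\ r x i = (x, i).
Proof.
have /choice[r rP] : forall xi : P * bool, exists u : P * bool,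
  (exists2 y, leader xi.1 xi.2 y & u = (y, second_end y xi.1)) \/
  (forall y, ~ leader xi.1 xi.2 y) /\ u = xi.
  move=> [x i]; have [[y xy]|/forallNP h] := pselect (exists y, leader x i y).
    by exists (y, second_end y x); left; exists y.
  by exists (x, i); right.
by exists (fun x i => r (x, i)) => x i; exact: (rP (x, i)).
Qed.

Variable r : P -> bool -> P * bool.
Hypothesis rP : forall x i,
  (exists2 y, leader x i y & r x i = (y, second_end y x)) \/
  (forall y, ~ leader x i y) /\ r x i = (x, i).

Lemma same_vertex_endpoint x i : same_vertex (x, i) (r x i).
Proof. by case: (rP x i) => [[y [xy e _ _] ->]|[_ ->]]; [right|left]. Qed.

(** If some end of this vertex had a colour below [c x], one of least colour would be a leader. *)
Lemma endpoint_color_least x i u : same_vertex (x, i) u -> c (r x i).1 <= c u.1.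
Proof.
move=> xu; case: (rP x i) => [[y [xy e cy ymin] ->]|[nolead ->]] /=.
  case: xu => [<-|[/= xu eu _]]; first exact: ltnW.
  by have [k uk] := fP xu; rewrite uk in xu eu *; exact: ymin.
rewrite leqNgt; apply/negP => cu; case: xu => [e|[/= xu eu _]].
  by rewrite -e ltnn in cu.
have [k0 uk] := fP xu; rewrite uk in xu eu cu.
pose B n := `[< exists k, [/\ A x (f k x), second_end x (f k x) = i & c (f k x) = n] >].
have ex : exists n, B n by exists (c (f k0 x)); apply/asboolP; exists k0.
case: (ex_minnP ex) => n /asboolP[k [xk ek cn]] nmin.
apply: (nolead (f k x)); split=> //.
  by rewrite cn; apply: leq_ltn_trans cu; apply: nmin; apply/asboolP; exists k0.
by move=> j xj ej; rewrite cn; apply: nmin; apply/asboolP; exists j.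
Qed.

(** Both representatives of one vertex have the least colour, while distinct ends of one vertex have
    adjacent carriers and hence different colours. *)
Lemma endpoint_eqP x i y j : r x i = r y j <-> same_vertex (x, i) (y, j).
Proof.
split=> [e|xy].
  apply: (same_vertex_trans (same_vertex_endpoint x i)); rewrite e.
  exact/same_vertex_sym/same_vertex_endpoint.
have yx := same_vertex_sym xy.
have ry := same_vertex_trans xy (same_vertex_endpoint y j).
have rx := same_vertex_trans yx (same_vertex_endpoint x i).
have cE : c (r x i).1 = c (r y j).1.
  by apply/eqP; rewrite eqn_leq !endpoint_color_least.
have [//|[rA _ _]] := same_vertex_trans (same_vertex_sym (same_vertex_endpoint x i)) ry.
by have := c_proper rA; rewrite cE eqxx.
Qed.

Lemma endpoints_neq x : r x false <> r x true.
Proof. by move/endpoint_eqP => [//|[/=]]; rewrite A_irr. Qed.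

Lemma adj_endpoints x y : x != y -> A x y <-> exists i j, r x i = r y j.
Proof.
move=> xy; split=> [Axy|[i [j /endpoint_eqP[[e]|[]//]]]]; last by rewrite e eqxx in xy.
by exists (second_end x y), (second_end y x); apply/endpoint_eqP; right.
Qed.

Lemma endpoints_inj x y i : r x false = r y i -> r x true = r y (~~ i) -> x = y.
Proof.
by move=> /endpoint_eqP[[]//|[/= _ e _]] /endpoint_eqP[[]//|[/= _ e' _]]; rewrite e in e'.
Qed.

Lemma color_le_borel (S : borelSpace) (g h : S -> bP) :
  sigma_algebra setT (@borel S) -> borel_fun g -> borel_fun h ->
  @borel S (fun s => c (g s) <= c (h s)).
Proof.
move=> S_sigma bg bh.
apply: (@borel_ext S (fun s => exists mn : nat * nat,
    mn.1 <= mn.2 /\ c (g s) == mn.1 /\ c (h s) == mn.2)).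
  move=> s; split=> [[[m n] [/= mn [/eqP -> /eqP ->]]]//|le].
  by exists (c (g s), c (h s)).
apply: borel_exists => // -[m n] /=; apply: borel_and => //; first exact: borel_cst.
by apply: borel_and => //; [exact: (bg _ (c_borel m))|exact: (bh _ (c_borel n))].
Qed.

Lemma leader_borel i : borel_rel (fun x y => leader x i y).
Proof.
move=> S S_sigma g h bg bh.
apply: (@borel_ext S (fun s => A (g s) (h s) /\ second_end (g s) (h s) == i /\
  ~~ (c (g s) <= c (h s)) /\ forall k, A (g s) (f k (g s)) ->
    second_end (g s) (f k (g s)) == i -> c (h s) <= c (f k (g s)))).
  move=> s; rewrite -ltnNge; split=> [[? [/eqP ? [? H]]]|[? /eqP ? ? H]].
    by split=> // k ? /eqP; exact: H.
  by do ![split] => // k ? /eqP; exact: H.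
have be (a b : S -> bP) : borel_fun a -> borel_fun b ->
    @borel S (fun s => second_end (a s) (b s) == i).
  move=> ba bb; apply: borel_eqb => //; [exact: second_end_borel|exact: borel_cst].
apply: borel_and => //; first exact: A_borel.
apply: borel_and => //; first exact: be.
apply: borel_and => //; first by apply: borel_negb => //; exact: color_le_borel.
apply: borel_forall => // k; have bf := borel_fun_comp (@f_borel k) bg.
apply: borel_imply => //; first exact: A_borel.
by apply: borel_imply => //; [exact: be|exact: color_le_borel].
Qed.

Lemma endpoint_borel (i : bool) (W : P -> bool -> Prop) :
  (forall b, @borel bP (fun x => W x b)) ->
  @borel bP (fun x => W (r x i).1 (r x i).2).
Proof.
move=> bW; have S := topo_borel_sigma P.
have bid : @borel_fun bP bP id by [].
have bWe (a b : bP -> bP) : borel_fun a -> borel_fun b ->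
    @borel bP (fun x => W (a x) (second_end (a x) (b x))).
  move=> ba bb; apply: (@borel_ext bP (fun x => exists b' : bool,
      second_end (a x) (b x) == b' /\ W (a x) b')).
    move=> x; split=> [[b' [/eqP ->]]//|]; by exists (second_end (a x) (b x)).
  apply: borel_exists => // b'; apply: borel_and => //; last exact: (ba _ (bW b')).
  by apply: borel_eqb => //; [exact: second_end_borel|exact: borel_cst].
apply: (@borel_ext bP (fun x =>
   (exists k, leader x i (f k x) /\ W (f k x) (second_end (f k x) x)) \/
   (~ (exists k, leader x i (f k x)) /\ W x i))).
  move=> x; have := rP x i => -[[y ly rE]|[nl rE]]; rewrite rE /=; last first.
    split=> [[[k [/nl]]|[]]//|Wx]; by right; split=> // -[k /nl].
  have [xy ey _ _] := ly; have [k0 yk0] := fP xy.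
  (* Distinct leaders on one side of [x] would be adjacent, hence differently coloured, although
     both have minimal colour. *)
  have ryE k : leader x i (f k x) -> f k x = y.
    move=> [xk ek ck kmin]; apply/eqP; apply: contrapT => /negP n.
    have s : star A lt x (f k x) y by rewrite -second_endE// ek ey.
    have /andP[/and3P[_ ky _] _] := s.
    have := c_proper ky; rewrite eqn_leq; have [_ _ _ ymin] := ly.
    by rewrite ymin// andbT {1}yk0 kmin// -yk0.
  split=> [[[k [/ryE ->]]|[[]]]//|Wy]; first by exists k0; rewrite -yk0.
  by left; exists k0; rewrite -yk0.
have bf k := @f_borel k.
apply: borel_or => //.
  apply: borel_exists => // k; apply: borel_and => //; first exact: leader_borel.
  exact: bWe.
apply: borel_and => //; apply: borel_notP => //; apply: borel_exists => // k.
exact: leader_borel.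
Qed.

(** The carrier of [u s] is [x] itself or a neighbour of [x], so [x] is some [f k (u s).1]; the case
    of [x] itself is [f 0 = id]. *)
Lemma endpoint_edges_borel (S : borelSpace) (u v : S -> P * bool) :
  sigma_algebra setT (@borel S) ->
  borel_fun (fun s => (u s).1 : bP) -> borel_fun (fun s => (v s).1 : bP) ->
  @borel S (fun s => (u s).2) -> @borel S (fun s => (v s).2) ->
  @borel S (fun s => exists x, r x false = u s /\ r x true = v s).
Proof.
move=> S_sigma bu bv bu2 bv2.
have beq i (g : S -> bP) (w : S -> P * bool) : borel_fun g ->
    borel_fun (fun s => (w s).1 : bP) -> @borel S (fun s => (w s).2) ->
    @borel S (fun s => r (g s) i = w s).
  move=> bg bw bw2; apply: (@borel_ext S (fun s =>
      ((r (g s) i).1 == (w s).1) && ((r (g s) i).2 == (w s).2))).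
    move=> s; split=> [/andP[/eqP e /eqP e2]|->]; rewrite ?eqxx//.
    by rewrite [RHS]surjective_pairing -e -e2 -surjective_pairing.
  have br1 : @borel_fun bP bP (fun x => (r x i).1).
    by move=> B bB; apply: (@endpoint_borel i (fun x _ => B x)).
  have br2 : @borel bP (fun x => (r x i).2).
    by apply: (@endpoint_borel i (fun _ b => b)) => b; exact: borel_cst (topo_borel_sigma P) _.
  apply: borel_andb => //.
    by apply: eq_borel => //; exact: (borel_fun_comp br1 bg).
  by apply: borel_eqb => //; exact: (bg _ br2).
apply: (@borel_ext S (fun s => exists k,
    r (f k (u s).1) false = u s /\ r (f k (u s).1) true = v s)).
  move=> s; split=> [[k]|[x [ru rv]]]; first by exists (f k (u s).1).
  suff [k xk] : exists k, x = f k (u s).1 by exists k; rewrite -xk.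
  have := same_vertex_endpoint x false; rewrite ru => -[<-|[/= xu _ _]].
    by exists 0; rewrite f0.
  by apply: fP; rewrite A_sym.
apply: borel_exists => // k; have bf := borel_fun_comp (@f_borel k) bu.
by apply: borel_and => //; exact: beq.
Qed.

End Ends.

(** * The Polish space of ends *)

Definition doubled (R : realType) (P : metricType R) : Type := (P * bool)%type.

Section DoubledMetric.
Variables (R : realType) (P : metricType R).
Local Open Scope ring_scope.

HB.instance Definition _ := Choice.on (doubled P).

(** The two copies of [P] are at distance at least [1], so balls of radius at most [1] stay in one
    copy. *)
Definition doubled_dist (u v : doubled P) : R := mdist u.1 v.1 + (u.2 != v.2)%:R.

Lemma doubled_distxx u : doubled_dist u u = 0.
Proof. by rewrite /doubled_dist mdistxx eqxx addr0. Qed.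

Lemma doubled_dist_eq0 u v : doubled_dist u v = 0 -> u = v.
Proof.
case: u v => [x i] [y j] /eqP; rewrite paddr_eq0 ?mdist_ge0//=.
move=> /andP[/eqP/mdist_positivity ->].
by rewrite pnatr_eq0 eqb0 negbK => /eqP ->.
Qed.

Lemma doubled_dist_sym u v : doubled_dist u v = doubled_dist v u.
Proof. by rewrite /doubled_dist metric_sym eq_sym. Qed.

Lemma doubled_dist_triangle v u w :
  doubled_dist u w <= doubled_dist u v + doubled_dist v w.
Proof.
rewrite /doubled_dist addrACA lerD ?metric_triangle//.
by case: u.2 v.2 w.2 => [] [] []; rewrite /= ?addr0 ?add0r // ler_wpDr.
Qed.

HB.instance Definition _ := isMetric.Build R (doubled P)
  doubled_distxx doubled_dist_eq0 doubled_dist_sym doubled_dist_triangle.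

Lemma ball_doubled (u v : doubled P) (e : R) : ball u e v <-> doubled_dist u v < e.
Proof. by []. Qed.

Lemma ball_doubled_small (u v : doubled P) (e : R) : e <= 1 ->
  ball u e v <-> mdist u.1 v.1 < e /\ u.2 = v.2.
Proof.
move=> e1; rewrite ball_doubled /doubled_dist; have := mdist_ge0 u.1 v.1.
have [->|uv] := eqVneq u.2 v.2; rewrite ?addr0 => d0.
  by split=> [|[]].
by split=> [h|[_ e2]]; [exfalso; move: h; rewrite /=; lra|rewrite e2 eqxx in uv].
Qed.

Lemma open_doubled (W : set (doubled P)) :
  (forall b, open [set x : P | W (x, b)]) <-> open W.
Proof.
split=> [oW|oW b].
  rewrite openE => -[x b] Wxb; have [e e0 eW] := open_mdistP (oW b) Wxb.
  apply/nbhs_ballP; exists (Num.min e 1) => /=; first by rewrite lt_min e0 ltr01.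
  move=> [y b'] /ball_doubled_small[]; first by rewrite ge_min lexx orbT.
  by rewrite /= lt_min => /andP[xy _] <-; exact: eW.
rewrite openE => x /= Wx; apply/nbhs_ballP.
have [e e0 eW] := open_mdistP oW Wx; exists e => // y; rewrite ballEmdist /= => xy.
by apply: eW; rewrite /mdist /= /doubled_dist /= eqxx addr0.
Qed.

Lemma doubled_separable : separable_space P -> separable_space (doubled P).
Proof.
move=> [D cD dD]; exists [set u | D u.1].
  have := countableX cD (countableP [set: bool]); apply: sub_countable.
  by apply: subset_card_le => u /= Du; split.
move=> W [[x b] Wxb] /open_doubled oW.
have [|y [Wy Dy]] := dD _ _ (oW b); first by exists x.
by exists (y, b).
Qed.

Lemma doubled_complete : complete_space P -> complete_space (doubled P).
Proof.
move=> P_complete F FF /cauchyP Fc.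
(* A ball of radius [1] in the filter fixes the bit [b] of the limit. *)
have [[x0 b] Fb] := Fc 1 ltr01.
have [x Fx] : exists x : P, fst @ F --> x.
  apply: (filter_cauchyP P_complete) => e e0.
  have m0 : 0 < Num.min (e / 2) 1 by rewrite lt_min divr2_gt0//= ltr01.
  have [u Fu] := Fc _ m0; exists [set y | mdist u.1 y < e / 2].
    have uS : ball u (Num.min (e / 2) 1) `<=` fst @^-1` [set y | mdist u.1 y < e / 2].
      move=> v /ball_doubled_small[]; first by rewrite ge_min lexx orbT.
      by rewrite /= lt_min => /andP[].
    exact: (filterS uS Fu).
  move=> y y' /= uy uy'; have := metric_triangle y u.1 y'.
  by rewrite (metric_sym y u.1); lra.
exists (x, b) => W; rewrite nbhsE => -[W' [/open_doubled oW' W'x] W'W].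
apply: filterS W'W _.
have : (fst @ F) [set y : P | W' (y, b)].
  by apply: Fx; apply: open_nbhs_nbhs; split=> //; exact: oW'.
rewrite /fmap /= => F1; apply: filterS (filterI Fb F1) => -[y b'] /=.
by move=> [/ball_doubled_small[//|/= _ <-]].
Qed.

Definition doubled_borel : borelSpace := topo_borel (doubled P).

Lemma doubled_standard : separable_space P -> complete_space P ->
  standard_borel R doubled_borel.
Proof.
move=> P_separable P_complete; exists (doubled P); split.
- exact: doubled_separable.
- exact: doubled_complete.
- exists id; first by exists id.
  rewrite /preimage_set_system; apply/seteqP; split=> B.
    by move=> bB; exists B; rewrite // setTI.
  by move=> [C bC <-]; rewrite setTI.
Qed.

Lemma borel_doubled1 : @borel_fun doubled_borel (topo_borel P) fst.
Proof.
apply: (@generated_preimage (topo_borel P) (@open P)) => //; first exact: topo_borel_sigma.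
by move=> U oU; apply: open_borel; apply/open_doubled.
Qed.

Lemma borel_doubled2 : @borel doubled_borel snd.
Proof.
apply: open_borel; apply/open_doubled => -[].
  by rewrite (_ : [set _ | _] = setT); [exact: openT|by apply/seteqP; split].
by rewrite (_ : [set _ | _] = set0); [exact: open0|by apply/seteqP; split].
Qed.

Lemma borel_doubled_section (W : set (doubled P)) b :
  @borel doubled_borel W -> @borel (topo_borel P) (fun x => W (x, b)).
Proof.
move: W; apply: (@generated_preimage doubled_borel (@open (doubled P)) (topo_borel P)
  (fun x => (x, b))) => //; first exact: topo_borel_sigma.
by move=> W /open_doubled oW; exact: open_borel (oW b).
Qed.

End DoubledMetric.

(** * Two-element sets and abstract root graphs *)

Lemma set2_eq (T : Type) (x y z w : T) : [set x; y] = [set z; w] ->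
  (x = z /\ y = w) \/ (x = w /\ y = z).
Proof.
move=> e.
have [xz|xw] : [set z; w] x by rewrite -e; left.
- have [yz|yw] : [set z; w] y by rewrite -e; right.
  + have [wx|wy] : [set x; y] w by rewrite e; right.
      by left; rewrite yz wx xz.
    by left; rewrite xz wy.
  + by left.
- have [yz|yw] : [set z; w] y by rewrite -e; right.
  + by right.
  + have [zx|zy] : [set x; y] z by rewrite e; left.
      by right; rewrite xw yw zx xw.
    by right; rewrite xw zy.
Qed.

Lemma two_subset_inj (T : Type) (e e' : two_subset T) : sval e = sval e' -> e = e'.
Proof.
by case: e e' => [a pa] [b pb] /= ab; subst b; congr exist; exact: Prop_irrelevance.
Qed.

Lemma adj_neq (G : graph) (x y : vertex G) : adj x y -> x <> y.
Proof. by case. Qed.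

Lemma adj_line_graph (V : Type) (E : set (two_subset V)) (e e' : E) :
  @adj (Graph (@line_edge _ E)) e e' <->
  e <> e' /\ sval (set_val e) `&` sval (set_val e') !=set0.
Proof.
split=> [[h [e1 [e2 [h12 [E12 m]]]]]|[h m]].
  have [[-> ->]//|[-> ->]] := set2_eq (congr1 sval E12 : [set e; e'] = [set e1; e2]).
  by split; [exact: nesym|rewrite setIC].
by exists h; exists e, e', h.
Qed.

Lemma root_ends (L : graph) (X : eqType) (g : X -> vertex L) :
  is_line_graph L -> injective g ->
  exists (V : eqType) (p q : X -> V),
  [/\ forall x, p x != q x,
      forall x y, inc p q x =1 inc p q y -> x = y &
      forall x y, `[< adj (g x) (g y) >] = inc p q x (p y) (+) inc p q x (q y)].
Proof.
move=> [G [F0 [F0bij F0adj]]] g_inj; pose F := F0 \o g.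
have Finj : injective F by apply: inj_comp => //; exact: bij_inj.
have Fadj x y : adj (g x) (g y) <-> adj (F x) (F y) by exact: F0adj.
have /choice[p /choice[q pq]] : forall x, exists a b : {classic vertex G},
    a <> b /\ sval (set_val (F x)) = [set a; b].
  by move=> x; case: (set_val (F x)) => e [a [b [ab E]]]; exists a, b.
exists {classic vertex G}, p, q.
have pqn x : p x != q x by apply/eqP; have [] := pq x.
have incE x v : inc p q x v <-> sval (set_val (F x)) v.
  have [_ ->] := pq x; rewrite /inc /=; split.
    by case/orP => /eqP <-; [left|right].
  by case=> ->; rewrite eqxx ?orbT.
have incI x y : inc p q x =1 inc p q y -> x = y.
  move=> e; apply: Finj; apply: val_inj; apply: two_subset_inj.
  apply/seteqP; split=> v /incE; first by rewrite e => /incE.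
  by rewrite -e => /incE.
split=> // x y.
have meet : (sval (set_val (F x)) `&` sval (set_val (F y)) !=set0) <->
    inc p q x (p y) || inc p q x (q y).
  split=> [[v [/incE xv /incE]]|].
    by rewrite {1}/inc => /orP[] /eqP ->; rewrite xv ?orbT.
  case/orP => h; [exists (p y)|exists (q y)]; split; apply/incE => //.
    by rewrite /inc eqxx.
  by rewrite /inc eqxx orbT.
have [<-|xy] := pselect (x = y).
  rewrite {1 2}/inc !eqxx orbT /=; apply/asboolPn => /adj_neq; exact.
have -> : `[< adj (g x) (g y) >] = (inc p q x (p y) || inc p q x (q y)).
  apply/asboolP/idP => [/Fadj/adj_line_graph[_ /meet]//|/meet m].
  by apply/Fadj/adj_line_graph; split=> // /Finj.
(* Inclusive and exclusive or differ only if [x] contains both endpoints of [y], which forces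
   [x = y]. *)
case xp : (inc p q x (p y)); case xq : (inc p q x (q y)) => //=; exfalso; apply: xy.
have ex : ends p q x (p y) (q y) by rewrite /ends pqn xp xq.
have ey : ends p q y (p y) (q y) by exact: ends_pq.
exact: ends_inj ex ey.
Qed.

Lemma standard_borel_set1 (R : realType) (X : borelSpace) (x : X) :
  standard_borel R X -> borel [set x].
Proof.
move=> [P [_ _ [f fbij ->]]]; exists [set f x].
  have cl : closed [set f x].
    exact/accessible_closed_set1/hausdorff_accessible/metric_hausdorff.
  rewrite -[[set f x]]setCK.
  exact: (borel_notP (topo_borel_sigma P) (open_borel (closed_openC cl))).
rewrite setTI; apply/seteqP; split=> y /=; last by move=> ->.
exact: (bij_inj fbij).
Qed.

(** * Existence of Borel endpoint maps *)

Section Construction.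
Variables (R : realType) (P : metricType R).
Hypotheses (P_separable : separable_space P) (P_complete : complete_space P).
Let bP := topo_borel P.
Variables (A : rel P) (c : P -> nat) (V : eqType) (p q : P -> V).
Hypothesis A_borel : borel_rel A.
Hypothesis c_borel : forall i, @borel bP (fun x => c x == i).
Hypothesis c_proper : forall x y, A x y -> c x != c y.
Hypothesis pq_neq : forall x, p x != q x.
Hypothesis pq_inj : forall x y, inc p q x =1 inc p q y -> x = y.
Hypothesis A_pq : forall x y, A x y = inc p q x (p y) (+) inc p q x (q y).

Lemma borel_root : exists r : P -> bool -> P * bool,
  [/\ forall x, r x false <> r x true,
      forall x y, x != y -> A x y <-> exists i j, r x i = r y j,
      forall x y i, r x false = r y i -> r x true = r y (~~ i) -> x = y,
      forall i (W : P -> bool -> Prop), (forall b, @borel bP (fun x => W x b)) ->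
        @borel bP (fun x => W (r x i).1 (r x i).2) &
      forall (S : borelSpace) (u v : S -> P * bool),
        sigma_algebra setT (@borel S) ->
        borel_fun (fun s => (u s).1 : bP) -> borel_fun (fun s => (v s).1 : bP) ->
        @borel S (fun s => (u s).2) -> @borel S (fun s => (v s).2) ->
        @borel S (fun s => exists x, r x false = u s /\ r x true = v s)].
Proof.
have A_sym := root_adj_sym pq_neq A_pq.
have A_irr := root_adj_irr A_pq.
have [lt [lt_irr lt_tour lt_borel]] := borel_tournament P_separable.
have eq_borel := borel_rel_eq lt_irr lt_tour lt_borel.
have s_trans := star_trans pq_neq pq_inj A_pq lt_tour.
have s_two := star_two pq_neq pq_inj A_pq lt_tour.
have claw := claw_free pq_neq pq_inj A_pq lt_tour.
have [f [f_borel f0 fP]] := neighbor_functions P_separable P_complete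
  lt_irr lt_tour lt_borel A_borel c_borel c_proper claw.
have [r rP] := endpoint_exists A lt c f.
exists r; split.
- exact: (endpoints_neq A_sym A_irr c_proper fP s_trans s_two rP).
- exact: (adj_endpoints A_sym A_irr c_proper fP s_trans s_two rP).
- exact: (endpoints_inj A_sym A_irr c_proper fP s_trans s_two rP).
- exact: (endpoint_borel A_borel lt_borel eq_borel A_sym c_borel c_proper
    f_borel fP s_trans s_two rP).
- exact: (endpoint_edges_borel A_borel lt_borel eq_borel A_sym c_borel c_proper
    f_borel f0 fP s_trans s_two rP).
Qed.

End Construction.

(** * Borel squares and the isomorphism with the line graph *)

Lemma square_borel_sigma (X : borelSpace) :
  sigma_algebra setT (@borel (square_borel X)).
Proof. exact: smallest_sigma_algebra. Qed.

Lemma square_borel1 (X : borelSpace) : @borel_fun (square_borel X) X fst.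
Proof. by move=> B bB; apply: sub_sigma_algebra; left; exists B; rewrite // setTI. Qed.

Lemma square_borel2 (X : borelSpace) : @borel_fun (square_borel X) X snd.
Proof. by move=> B bB; apply: sub_sigma_algebra; right; exists B; rewrite // setTI. Qed.

Lemma borel_fun_pair (S X : borelSpace) (g h : S -> X) :
  sigma_algebra setT (@borel S) -> borel_fun g -> borel_fun h ->
  @borel_fun S (square_borel X) (fun s => (g s, h s)).
Proof.
move=> S_sigma bg bh; apply: (@generated_preimage (square_borel X) _ S _ S_sigma erefl) => U.
by case=> -[B bB <-]; rewrite setTI; [exact: bg|exact: bh].
Qed.

Theorem corollary1p5 (R : realType) (L : graphOnBorel)
    (L_borel : is_borel_graph R L)
    (L_locally_countable : locally_countable L)
    (L_line : is_line_graph L)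
    (L_chi : borel_chromatic_number_le_aleph0 R L) :
  is_borel_line_graph R L.
Proof.
split=> //; have [[P [P_sep P_compl [phi phi_bij L_phi]]] edge_borel] := L_borel.
have [psi phiK psiK] := phi_bij.
have phi_borel : @borel_fun (vspace L) (topo_borel P) phi.
  by move=> B bB; rewrite L_phi; exists B; rewrite // setTI.
have psi_borel (S : borelSpace) (g : S -> topo_borel P) :
    borel_fun g -> @borel_fun S (vspace L) (psi \o g).
  move=> bg B; rewrite L_phi => -[C bC <-]; rewrite setTI.
  rewrite (_ : _ @^-1` _ = g @^-1` C); first exact: bg.
  by apply/seteqP; split=> s; rewrite /preimage /= psiK.
(* The graph is transported to the Polish space [P]. *)
pose A : rel P := fun x y => `[< @adj L (psi x) (psi y) >].
have A_borel : borel_rel A.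
  move=> S S_sigma g h bg bh; apply: borel_asbool => //.
  exact: (borel_fun_pair S_sigma (psi_borel _ _ bg) (psi_borel _ _ bh) edge_borel).
have [V [p [q [pq_neq pq_inj A_pq]]]] := root_ends L_line (can_inj psiK).
have [X [X_std [col col_borel col_proper] _] /countable_injP[num num_inj]] := L_chi.
(* [num] injects the countable colour space into [nat]; singletons are Borel in a standard Borel
   space, so the colour classes remain Borel. *)
pose c (x : P) := num (col (psi x)).
have c_borel i : @borel (topo_borel P) (fun x => c x == i).
  have bid : @borel_fun (topo_borel P) (topo_borel P) id by [].
  have [[x nx]|/forallNP nx] := pselect (exists x, num x = i).
    have := psi_borel _ _ bid _ (col_borel _ (standard_borel_set1 x X_std)).
    apply: borel_ext => y; rewrite /= /c -nx; split=> [->//|/eqP /num_inj].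
    by apply; rewrite inE.
  apply: (@borel_ext (topo_borel P) (fun _ => False)).
    by move=> y; split=> // /eqP /nx.
  exact: borel_cst (topo_borel_sigma P) _.
have c_proper x y : A x y -> c x != c y.
  move=> /asboolP /col_proper cxy; apply/eqP => /num_inj e.
  by apply: cxy; apply: e; exact: in_setT.
have [r [r_neq r_adj r_inj r_borel r_edge]] :=
  borel_root P_sep P_compl A_borel c_borel c_proper pq_neq pq_inj A_pq.
pose W := doubled_borel P.
pose E : set (two_subset W) := [set e | exists x, sval e = [set r x false; r x true]].
pose G := @GraphOnBorel W E.
have W_sigma : sigma_algebra setT (@borel W) by exact: topo_borel_sigma.
exists G.
  split; first exact: doubled_standard.
  have S_sigma := square_borel_sigma W.
  have b1 := @square_borel1 W; have b2 := @square_borel2 W.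
  have bfst (g : square_borel W -> W) : borel_fun g ->
      @borel_fun (square_borel W) (topo_borel P) (fun s => (g s).1).
    by move=> bg; exact: borel_fun_comp (@borel_doubled1 _ P) bg.
  have bsnd (g : square_borel W -> W) : borel_fun g ->
      @borel (square_borel W) (fun s => (g s).2).
    by move=> bg; exact: (bg _ (@borel_doubled2 _ P)).
  (* An unordered edge is met in either orientation, and [r_edge] handles each. *)
  apply: (@borel_ext (square_borel W) (fun s =>
      (exists x, r x false = s.1 /\ r x true = s.2) \/
      (exists x, r x false = s.2 /\ r x true = s.1))).
    move=> [u v] /=; split.
      case=> -[x [e1 e2]].
        exists (fun uv => r_neq x (etrans e1 (etrans uv (esym e2)))).
        by exists x; rewrite /= e1 e2.
      exists (fun uv => r_neq x (etrans e1 (etrans (esym uv) (esym e2)))).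
      by exists x; rewrite /= e1 e2 setUC.
    move=> [h [x e]].
    by have [[e1 e2]|[e1 e2]] := set2_eq (e : [set u; v] = [set r x false; r x true]);
      [left|right]; exists x.
  by apply: borel_or => //; apply: r_edge => //; auto.
pose F0 (z : vspace L) : two_subset W := upair (r_neq (phi z)).
have F0E z : E (F0 z) by exists (phi z).
pose F (z : vspace L) : E := exist _ (F0 z) (mem_set (F0E z)).
have F_inj : injective F.
  move=> z z' Fzz'; apply: (bij_inj phi_bij).
  have e : [set r (phi z) false; r (phi z) true] =
      [set r (phi z') false; r (phi z') true].
    exact: (congr1 (fun e : E => sval (set_val e)) Fzz').
  by case: (set2_eq e) => -[e1 e2]; [apply: (r_inj _ _ false)|apply: (r_inj _ _ true)].
have F_surj e : exists z, F z = e.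
  have [x ex] : E (set_val e) by exact: set_valP.
  exists (psi x); apply: val_inj; apply: two_subset_inj.
  by rewrite /= psiK ex.
have [F' F'P] := choice F_surj.
exists F.
  split; first by exists F' => z //; apply: F_inj; rewrite F'P.
  move=> z z'; rewrite adj_line_graph /=.
  have [->|zz'] := pselect (z = z'); first by split=> [/adj_neq|[]].
  have AE : adj z z' <-> A (phi z) (phi z') by rewrite /A asboolE !phiK.
  have nphi : phi z != phi z' by apply/eqP => /(bij_inj phi_bij).
  rewrite AE (r_adj _ _ nphi); split=> [[i [j e]]|[_ [w [w1 w2]]]].
    split; first by move/F_inj.
    exists (r (phi z) i); split; first by case: i {e} => /=; [right|left].
    by rewrite e; case: j {e} => /=; [right|left].
  have H y : [set r (phi y) false; r (phi y) true] w -> exists i, w = r (phi y) i.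
    by case=> ->; [exists false|exists true].
  by have [i wi] := H _ w1; have [j wj] := H _ w2; exists i, j; rewrite -wi.
(* A Borel set of edges is the trace of a Borel set [B'] of two-element sets, so it suffices that
   the ordered pair of endpoints depends on [z] in a Borel way. *)
move=> B [B' bB' <-]; rewrite setTI.
have rb i : @borel_fun (vspace L) W (fun z => r (phi z) i).
  move=> D bD; apply: (phi_borel (fun x => D (r x i))).
  apply: (@borel_ext (topo_borel P) (fun x => D ((r x i).1, (r x i).2))).
    by move=> x; rewrite -surjective_pairing.
  apply: (r_borel i (fun x b => D (x, b))) => b; exact: borel_doubled_section.
have L_sigma : sigma_algebra setT (@borel (vspace L)).
  rewrite L_phi; exact: sigma_algebra_preimage (topo_borel_sigma P).
have := borel_fun_pair L_sigma (rb false) (rb true) bB'.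
apply: borel_ext => z; split=> [[h]|h]; last by exists (r_neq (phi z)).
by rewrite (_ : upair h = F0 z)//; exact: two_subset_inj.
Qed.
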